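(* Let $v=(\alpha,\beta)^t\in\mathbb{R}^2$ be such that $\alpha,\beta$ are irrational and $1,\alpha,\beta$ are linearly dependent over $\mathbb{Q}$. Then there exist two reductive subgroups $H^{(1)},H^{(2)}$ of $\mathrm{SL}_3(\mathbb{R})$ containing $A$, and two lattices $y_1,y_2\in X_3$, such that the orbits $H^{(i)}y_i$ $(i=1,2)$ are closed and such that: (1) $\overline{Ax_v}\subset Ax_v\cup H^{(1)}y_1\cup H^{(2)}y_2$; (2) the orbit $Ax_v$ is disjoint from $H^{(i)}y_i$ for $i=1,2$; (3) $\overline{Ax_v}\cap H^{(i)}y_i\neq\emptyset$ for $i=1,2$. A corresponding statement for the lattice $z_v$ holds, with different groups $H^{(i)}$: there exist two reductive subgroups of $\mathrm{SL}_3(\mathbb{R})$ containing $A$, different from the groups $H^{(i)}$ for $x_v$, and two lattices in $X_3$, such that the corresponding orbits are closed and (1)–(3) hold with $z_v$ in place of $x_v$. In particular, $x_v$ and $z_v$ are irregular for the $A$-action.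
   Context: $X_3=\mathrm{SL}_3(\mathbb{R})/\mathrm{SL}_3(\mathbb{Z})$, with $\mathrm{SL}_3(\mathbb{R})$ acting by left multiplication, is identified with the space of unit covolume lattices in $\mathbb{R}^3$ (the coset of $g$ corresponds to the lattice spanned by the columns of $g$). $A<\mathrm{SL}_3(\mathbb{R})$ is the group of diagonal matrices of determinant $1$ with positive diagonal entries. For $v=(\alpha,\beta)^t$, $x_v$ and $z_v$ are the lattices in $X_3$ spanned by the columns of, respectively, $$h_v=\begin{pmatrix}1&0&0\\ \alpha&1&0\\ \beta&0&1\end{pmatrix},\qquad g_v=\begin{pmatrix}1&\alpha&\beta\\ 0&1&0\\ 0&0&1\end{pmatrix}.$$ A point $x\in X_3$ is $A$-regular if $\overline{Ax}=Lx$ for some closed subgroup $L$ with $A<L<\mathrm{SL}_3(\mathbb{R})$; it is irregular for the $A$-action if it is not $A$-regular. *)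

(* Defs.v *)
From HB Require Import structures.
From mathcomp Require Import all_boot all_order all_algebra.
From mathcomp Require Import all_classical all_reals all_analysis.
(* Not imported: its notations clash with those of mathcomp-analysis. *)
From mathcomp Require mpoly.

Set Implicit Arguments.
Unset Strict Implicit.
Unset Printing Implicit Defensive.

Import Order.TTheory GRing.Theory Num.Theory.
Import numFieldNormedType.Exports.
Local Open Scope classical_set_scope.
Local Open Scope ring_scope.
Local Open Scope quotient_scope.

Definition SL3 (R : realType) : Type := {M : 'M[R]_3 | \det M == 1}.

HB.instance Definition _ (R : realType) := SubChoice.on (SL3 R).
HB.instance Definition _ (R : realType) :=
  Topological.copy (SL3 R) (initial_topology (val : SL3 R -> 'M[R]_3)).

Section SL3Group.
Variable R : realType.
Implicit Types g h k : SL3 R.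

Fact SL3_det g : \det (val g) = 1. Proof. exact/eqP/(valP g). Qed.

Fact SL3_unit g : val g \in unitmx.
Proof. by rewrite unitmxE SL3_det unitr1. Qed.

Fact SL3_one_subproof : \det (1%:M : 'M[R]_3) == 1.
Proof. by rewrite det1. Qed.

Fact SL3_mul_subproof g h : \det (val g *m val h) == 1.
Proof. by rewrite det_mulmx !SL3_det mulr1. Qed.

Fact SL3_inv_subproof g : \det (invmx (val g)) == 1.
Proof. by rewrite det_inv SL3_det invr1. Qed.

Definition SL3_one : SL3 R := Sub 1%:M SL3_one_subproof.
Definition SL3_mul g h : SL3 R := Sub (val g *m val h) (SL3_mul_subproof g h).
Definition SL3_inv g : SL3 R := Sub (invmx (val g)) (SL3_inv_subproof g).

Fact SL3_mulA : associative SL3_mul.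
Proof. by move=> g h k; apply: val_inj; rewrite /= mulmxA. Qed.
Fact SL3_mul1 : left_id SL3_one SL3_mul.
Proof. by move=> g; apply: val_inj; rewrite /= mul1mx. Qed.
Fact SL3_mulr1 : right_id SL3_one SL3_mul.
Proof. by move=> g; apply: val_inj; rewrite /= mulmx1. Qed.
Fact SL3_mulV : left_inverse SL3_one SL3_inv SL3_mul.
Proof. by move=> g; apply: val_inj; rewrite /= mulVmx ?SL3_unit. Qed.
Fact SL3_mulrV : right_inverse SL3_one SL3_inv SL3_mul.
Proof. by move=> g; apply: val_inj; rewrite /= mulmxV ?SL3_unit. Qed.

HB.instance Definition _ := isGroup.Build (SL3 R)
  SL3_mulA SL3_mul1 SL3_mulr1 SL3_mulV SL3_mulrV.

End SL3Group.

Section Subgroups.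
Variable R : realType.
Local Open Scope group_scope.
Implicit Types G H U L : set (SL3 R).

Definition subgroup H : Prop :=
  H 1 /\ forall g h, H g -> H h -> H (g * h^-1).

Definition A_group : set (SL3 R) :=
  [set g | is_diag_mx (val g) /\ forall i, (0 < val g i i)%R].

(* The matrix entries are the values of the 3 * 3 polynomial variables. *)
Definition zariski_closed G : Prop :=
  exists P : set (mpoly.mpoly (3 * 3) R),
    G = [set g | forall p, P p ->
                   mpoly.meval (fun k => mxvec (val g) ord0 k) p = 0%R].

Definition unipotent (g : SL3 R) : Prop :=
  exists n : nat, ((val g - 1%:M) ^+ n = 0)%R.

Definition normal_in U G : Prop :=
  U `<=` G /\ forall g u, G g -> U u -> U (g * u * g^-1).

(* A Zariski closed subgroup G is the group of real points of its Zariski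
   closure, and G is dense there; the real points of the unipotent radical of
   that closure form the largest subgroup U as below. *)
Definition trivial_unipotent_radical G : Prop :=
  forall U, subgroup U -> zariski_closed U -> connected U ->
    normal_in U G -> U `<=` unipotent -> U = [set 1].

(* A reductive subgroup is an open (equivalently, finite index) subgroup of the
   real points of a reductive algebraic group. Zariski closedness of H itself
   is not required: it fails already for the group A. *)
Definition reductive H : Prop :=
  subgroup H /\
  exists G, [/\ subgroup G, zariski_closed G, trivial_unipotent_radical G &
    exists2 O : set (SL3 R), open O & H = O `&` G].

End Subgroups.

Section SpaceOfLattices.
Variable R : realType.
Local Open Scope group_scope.
Implicit Types g h : SL3 R.

Definition integral_mx g : bool := val g \is a mxOver (@Num.int R).

(* The left cosets g SL_3(Z): g and h span the same lattice by their columns. *)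
Definition coset_rel g h : bool := integral_mx (g^-1 * h).

Fact integral_mxM g h : integral_mx g -> integral_mx h -> integral_mx (g * h).
Proof. by move=> gZ hZ; apply: mxOverM. Qed.

Fact integral_mxV g : integral_mx g -> integral_mx g^-1.
Proof.
move=> /mxOverP gZ; apply/mxOverP => i j.
rewrite /= /invmx SL3_unit SL3_det invr1 scale1r mxE /cofactor.
apply: rpredM; first by rewrite rpredX // rpredN rpred1.
rewrite /determinant; apply: rpred_sum => s _.
apply: rpredM; first by rewrite rpredX // rpredN rpred1.
by apply: rpred_prod => k _; rewrite !mxE.
Qed.

Fact coset_rel_refl : reflexive coset_rel.
Proof.
by move=> g; rewrite /coset_rel mulVg; apply/mxOverP => i j; rewrite mxE rpred_nat.
Qed.

Fact coset_rel_sym : symmetric coset_rel.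
Proof.
by move=> g h; apply/idP/idP => /integral_mxV; rewrite invgM invgK.
Qed.

Fact coset_rel_trans : transitive coset_rel.
Proof.
move=> h g k gh hk.
by have := integral_mxM gh hk; rewrite mulgA mulgK.
Qed.

Definition coset_equiv : equiv_rel (SL3 R) :=
  EquivRel coset_rel coset_rel_refl coset_rel_sym coset_rel_trans.

Definition X3 : Type := quotient_topology {eq_quot coset_equiv}.

HB.instance Definition _ := Topological.on X3.
HB.instance Definition _ := Quotient.on X3.

Definition lattice_of g : X3 := \pi_(X3)%qT g.

Definition act g (x : X3) : X3 := lattice_of (g * repr x).

Lemma lattice_of_eqP g h : coset_rel g h <-> lattice_of g = lattice_of h.
Proof.
split=> [gh|gh]; first exact/(@eqmodP _ coset_equiv g h).
by apply/(@eqmodP _ coset_equiv g h); exact: gh.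
Qed.

Lemma act_lattice_of g h : act g (lattice_of h) = lattice_of (g * h).
Proof.
apply/lattice_of_eqP.
have /lattice_of_eqP : lattice_of (repr (lattice_of h)) = lattice_of h.
  exact: reprK.
by rewrite /coset_rel invgM -!mulgA mulKg.
Qed.

Definition orbit_of (H : set (SL3 R)) (x : X3) : set X3 := [set act h x | h in H].

(* As usual for subgroups, A < L and L < SL_3(R) are not meant strictly. *)
Definition A_regular (x : X3) : Prop :=
  exists L : set (SL3 R),
    [/\ subgroup L, closed L, @A_group R `<=` L &
        closure (orbit_of (@A_group R) x) = orbit_of L x].

Definition irregular (x : X3) : Prop := ~ A_regular x.

Record closed_reductive_orbit (H : set (SL3 R)) (y : X3) : Prop := {
  cro_reductive : reductive H;
  cro_A : @A_group R `<=` H;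
  cro_closed : closed (orbit_of H y) }.

Record orbit_closure_in (x : X3) (H1 H2 : set (SL3 R)) (y1 y2 : X3) : Prop := {
  oci_sub : closure (orbit_of (@A_group R) x) `<=`
    orbit_of (@A_group R) x `|` orbit_of H1 y1 `|` orbit_of H2 y2;
  oci_disj1 : orbit_of (@A_group R) x `&` orbit_of H1 y1 = set0;
  oci_disj2 : orbit_of (@A_group R) x `&` orbit_of H2 y2 = set0;
  oci_meet1 : closure (orbit_of (@A_group R) x) `&` orbit_of H1 y1 !=set0;
  oci_meet2 : closure (orbit_of (@A_group R) x) `&` orbit_of H2 y2 !=set0 }.

End SpaceOfLattices.

Section TheLattices.
Variable R : realType.
Implicit Types alpha beta : R.

Definition h_mx alpha beta : 'M[R]_3 :=
  \matrix_(i < 3, j < 3)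
    (nth [::] [:: [:: 1;     0; 0];
                  [:: alpha; 1; 0];
                  [:: beta;  0; 1]] i)`_j.

Definition g_mx alpha beta : 'M[R]_3 :=
  \matrix_(i < 3, j < 3)
    (nth [::] [:: [:: 1; alpha; beta];
                  [:: 0; 1;     0];
                  [:: 0; 0;     1]] i)`_j.

Fact h_mx_det alpha beta : \det (h_mx alpha beta) == 1.
Proof.
rewrite det_trig; first by rewrite !big_ord_recl big_ord0 !mxE /= !mulr1.
by apply/is_trig_mxP => -[[|[|[|//]]] ?] [[|[|[|//]]] ?]; rewrite ?mxE.
Qed.

Fact g_mx_det alpha beta : \det (g_mx alpha beta) == 1.
Proof.
suff -> : g_mx alpha beta = (h_mx alpha beta)^T by rewrite det_tr h_mx_det.
by apply/matrixP => -[[|[|[|//]]] ?] [[|[|[|//]]] ?]; rewrite !mxE.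
Qed.

Definition h_v alpha beta : SL3 R := Sub (h_mx alpha beta) (h_mx_det alpha beta).
Definition g_v alpha beta : SL3 R := Sub (g_mx alpha beta) (g_mx_det alpha beta).

Definition x_v alpha beta : X3 R := lattice_of (h_v alpha beta).
Definition z_v alpha beta : X3 R := lattice_of (g_v alpha beta).

Definition rat_dependent alpha beta : Prop :=
  exists p q r : rat, (p, q, r) <> (0, 0, 0) /\
    ratr p * 1 + ratr q * alpha + ratr r * beta = 0.

End TheLattices.

(* Main.v *)
From HB Require Import structures.
Require Import Defs.
From mathcomp Require Import all_boot all_order all_algebra.
From mathcomp Require Import ring lra zify.
From mathcomp Require Import all_classical all_reals all_analysis.
From mathcomp Require mpoly.

(** Write [h] for the matrix of [x_v] and let [s = (0, q, r)], where
    [p + q * alpha + r * beta = 0] is the given relation; irrationality of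
    [alpha] and [beta] forces [q] and [r] to be nonzero. Two features of [h] carry
    the proof: the second and third coordinate axes contain lattice vectors,
    since [h] fixes the basis vectors [e_2] and [e_3], and the linear form [s]
    takes rational values on the lattice, since [s h = (- p, q, r)].

    Let [a_n h c_n] converge to [g], where [a_n] is diagonal with entries
    [a_n1, a_n2, a_n3] and [c_n] is integral. In the coordinates given by the
    columns of [a_n h c_n], the lattice vectors [a_n2 e_2] and [a_n3 e_3] are
    nonzero integral columns, and the form [(0, q / a_n2, r / a_n3)] is a nonzero
    row with bounded denominators. Whenever these objects converge, their
    coordinates are eventually constant ([int_mx_cvg_eventually]). So neither
    [a_n2] nor [a_n3] tends to 0, and they do not both tend to infinity. If both
    stay bounded, then [c_n] is eventually constant and [g] lies in the orbit of
    [x_v] under the diagonal group ([diag_limit_bounded]). If only one of the two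
    stays bounded, say the i-th entry, then the i-th axis contains a vector of the
    limit lattice and the limit form is a multiple of the i-th coordinate form. The
    coordinates of the vector and of the form are those of [e_i] and [s] in a basis of [x_v],
    whatever the sequence is, and this determines the limit lattice up to the
    block group GL_1 x GL_2 attached to the i-th axis ([block_limit]). The same
    argument shows that the block orbit obtained in this way is closed
    ([block_orbit_closed]).

    These orbits do not meet the orbit of [x_v]: a lattice in a block orbit has a
    coordinate form that is proportional to a rational one ([block_orbit_splits]),
    which irrationality excludes for [x_v]. They do meet its closure: good
    rational approximations of the other coordinate of [v] yield bounded bases of
    [a_n x_v] for some [a_n] whose i-th entry is 1 and whose other entry among
    [a_n2] and [a_n3] tends to infinity ([bounded_representatives]).

    For irregularity, let the closure of the orbit of [x = x_v] be [L x], and let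
    [l] be in [L] with [l x] in a block orbit. For diagonal [a] close to 1,
    the point [l^-1 a l x] of the closure is close to [x], hence outside the closed
    block orbits, hence of the form [a' x]; properness of the orbit map at [x]
    gives [l^-1 a l = a']. Thus [l] is monomial, and then [x] itself would have a
    coordinate axis and a coordinate form that are both rational
    ([diag_orbit_irregular]).

    Finally [z_v] is the dual lattice of [x_(-v)]. Transposed inversion preserves
    the diagonal group and all block groups, so that everything carries over. The
    limits found above even lie in the orbit of the subgroup of index 2 of the
    block group that preserves the direction of the axis. The full block groups
    serve for [x_v] and these subgroups for [z_v], which makes the groups
    different. *)

Set Implicit Arguments.
Unset Strict Implicit.
Unset Printing Implicit Defensive.

Import Order.TTheory GRing.Theory Num.Theory.
Import numFieldNormedType.Exports.
Local Open Scope classical_set_scope.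
Local Open Scope ring_scope.

(** * Limits of matrices, of integers and along ultrafilters *)

Section MatrixConvergence.
Variables (R : realType) (T : Type) (F : set_system T).
Context {FF : Filter F}.

Lemma cvg_mxP m n (M : T -> 'M[R]_(m, n)) (L : 'M[R]_(m, n)) :
  M @ F --> L <-> forall i j, (fun t => M t i j) @ F --> L i j.
Proof.
split=> [ML i j A LA|ML A [P LP sPA]].
  have /ML : nbhs L [set N : 'M[R]_(m, n) | A (N i j)].
    exists (fun k l => if (k == i) && (l == j) then A else setT) => [k l|N /= AN].
      by case: andP => [[/eqP-> /eqP->] //|_]; exact: filterT.
    by have := AN i j; rewrite !eqxx.
  by [].
have FP : \forall t \near F, forall k : 'I_m * 'I_n, P k.1 k.2 (M t k.1 k.2).
  by apply: filter_forall => -[i j]; exact: ML.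
by apply: filterS FP => t Pt; apply: sPA => i j; exact: (Pt (i, j)).
Qed.

Lemma cvg_mulmx m n p (M : T -> 'M[R]_(m, n)) (N : T -> 'M[R]_(n, p))
    (M' : 'M[R]_(m, n)) (N' : 'M[R]_(n, p)) :
  M @ F --> M' -> N @ F --> N' -> (fun t => M t *m N t) @ F --> M' *m N'.
Proof.
move=> /cvg_mxP MM' /cvg_mxP NN'; apply/cvg_mxP => i j.
rewrite mxE; under eq_cvg do rewrite mxE.
by apply: cvg_big => [|k _]; [exact: add_continuous|exact: cvgM].
Qed.

Lemma cvg_det n (M : T -> 'M[R]_n) (M' : 'M[R]_n) :
  M @ F --> M' -> (fun t => \det (M t)) @ F --> \det M'.
Proof.
move=> /cvg_mxP MM'; apply: cvg_big => [|s _]; first exact: add_continuous.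
apply: cvgM; first exact: cvg_cst.
by apply: cvg_big => [|k _]; [exact: mul_continuous|exact: MM'].
Qed.

Lemma cvg_adj n (M : T -> 'M[R]_n) (M' : 'M[R]_n) :
  M @ F --> M' -> (fun t => \adj (M t)) @ F --> \adj M'.
Proof.
move=> /cvg_mxP MM'; apply/cvg_mxP => i j.
rewrite !mxE; under eq_cvg do rewrite mxE.
apply: cvgM; first exact: cvg_cst.
apply: cvg_det; apply/cvg_mxP => k l; rewrite !mxE.
by under eq_cvg do rewrite !mxE; exact: MM'.
Qed.

Lemma cvg_SL3P (g_ : T -> SL3 R) (g : SL3 R) :
  g_ @ F --> g <-> (fun t => val (g_ t)) @ F --> val g.
Proof.
split=> [gg|gg].
  have vc : continuous (val : SL3 R -> 'M[R]_3) := @initial_continuous (SL3 R) _ _.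
  exact: (cvg_comp _ _ gg (vc g)).
move=> A; rewrite nbhsE => -[_ [[B Bop <-] Bg] sBA].
by apply: filterS sBA _; apply: gg; exact: open_nbhs_nbhs.
Qed.

Lemma cvg_SL3_entry (g_ : T -> SL3 R) (g : SL3 R) i j :
  g_ @ F --> g -> (fun t => val (g_ t) i j) @ F --> val g i j.
Proof. by move=> /cvg_SL3P/cvg_mxP. Qed.

Lemma cvg_SL3M (g_ h_ : T -> SL3 R) (g h : SL3 R) :
  g_ @ F --> g -> h_ @ F --> h -> (fun t => (g_ t * h_ t)%g) @ F --> (g * h)%g.
Proof. by move=> /cvg_SL3P gg /cvg_SL3P hh; apply/cvg_SL3P/cvg_mulmx. Qed.

Lemma val_SL3V (g : SL3 R) : val (g^-1)%g = \adj (val g).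
Proof. by rewrite /= /invmx SL3_unit SL3_det invr1 scale1r. Qed.

Lemma cvg_SL3V (g_ : T -> SL3 R) (g : SL3 R) :
  g_ @ F --> g -> (fun t => (g_ t)^-1%g) @ F --> (g^-1)%g.
Proof.
move=> /cvg_SL3P gg; apply/cvg_SL3P; rewrite val_SL3V.
by under eq_cvg do rewrite val_SL3V; exact: cvg_adj.
Qed.

End MatrixConvergence.

Section IntegerLimits.
Variables (R : realType) (T : Type) (F : set_system T).
Context {FF : ProperFilter F}.

(** Distinct integers are at distance at least 1, so a Cauchy family of
    integers is eventually constant. *)
Lemma int_cvg_eventually (f : T -> R) (l : R) :
  (\forall t \near F, f t \is a Num.int) -> f @ F --> l ->
  \forall t \near F, f t = l.
Proof.
move=> fZ fl.
have /cvgrPdist_lt/(_ (1 / 2)) near_l := fl.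
have h0 : 0 < 1 / 2 :> R by rewrite divr_gt0.
have {near_l} := near_l h0; move=> near_l.
have [t0 [ft0Z ft0]] := filter_ex (filterI fZ near_l).
have fc : \forall t \near F, f t = f t0.
  apply: filterS (filterI fZ near_l) => t [ftZ ft].
  have dZ : f t - f t0 \is a Num.int by rewrite rpredB.
  apply/eqP; rewrite -subr_eq0; have [//|nz] := eqVneq (f t - f t0) 0.
  have := norm_intr_ge1 dZ nz; rewrite leNgt => /negP[].
  have -> : f t - f t0 = (l - f t0) - (l - f t) by rewrite opprB addrCA addrAC subrr add0r.
  apply: (le_lt_trans (ler_normB _ _)); rewrite [ltRHS](splitr 1); exact: ltrD.
have fc' : f @ F --> f t0.
  by apply: cvg_near_cst fc.
by rewrite (cvg_unique (@norm_hausdorff _ _) fl fc').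
Qed.

Lemma int_mx_cvg_eventually m n (M : T -> 'M[R]_(m, n)) (L : 'M[R]_(m, n)) :
  (\forall t \near F, M t \is a mxOver Num.int) -> M @ F --> L ->
  \forall t \near F, M t = L.
Proof.
move=> MZ /cvg_mxP ML.
have : \forall t \near F, forall k : 'I_m * 'I_n, M t k.1 k.2 = L k.1 k.2.
  apply: filter_forall => -[i j]; apply: int_cvg_eventually (ML i j).
  by apply: filterS MZ => t /mxOverP.
by apply: filterS => t Mt; apply/matrixP => i j; exact: (Mt (i, j)).
Qed.

End IntegerLimits.

Section UltraLimits.
Variables (R : realType) (T : Type) (F : set_system T).
Context {UF : UltraFilter F}.

Lemma ultra_bounded_cvg (f : T -> R) (M : R) :
  (\forall t \near F, `|f t| <= M) -> exists l : R, f @ F --> l.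
Proof.
move=> fM.
have FfU : UltraFilter (f @ F).
  split=> [|G GG sFG]; first exact: fmap_proper_filter.
  apply/seteqP; split=> // A GA.
  have [//|FnA] := in_ultra_setVsetC (f @^-1` A) UF.
  have GnA : G (~` A) by exact: sFG.
  by have [x []] := filter_ex (filterI GA GnA).
have := @segment_compact R (- M) M; rewrite compact_ultra => /(_ _ FfU) [].
  by apply: filterS fM => t; rewrite /= in_itv /= ler_norml.
by move=> l [_ fl]; exists l.
Qed.

(** Along an ultrafilter there is no oscillation: a quantity converges or
    tends to infinity. *)
Lemma ultra_cvg_or_inv0 (f : T -> R) :
  (exists l : R, f @ F --> l) \/ (fun t => (f t)^-1) @ F --> (0 : R).
Proof.
have [[M fM]|unb] := pselect (exists M : R, \forall t \near F, `|f t| <= M).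
  by left; exact: ultra_bounded_cvg fM.
right; apply/cvgrPdist_lt => e e0.
have [fe|] := in_ultra_setVsetC [set t | `|f t| <= e^-1] UF.
  by case: unb; exists e^-1.
apply: filterS => t /= /negP; rewrite -ltNge sub0r normrN normfV => ft.
by rewrite invf_plt // posrE; apply: lt_trans ft; rewrite invr_gt0.
Qed.

End UltraLimits.

(** * Adherent points of orbits in the space of lattices *)

Section LatticeSpace.
Variable R : realType.
Local Open Scope group_scope.
Implicit Types (g h k : SL3 R) (S : set (SL3 R)).

Lemma lattice_of_repr (y : X3 R) : lattice_of (repr y) = y.
Proof. exact: reprK. Qed.

Lemma lattice_of_mulZ g h :
  lattice_of g = lattice_of h <-> exists2 k, integral_mx k & g = h * k.
Proof.
split=> [/esym/lattice_of_eqP hg|[k kZ ->]].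
  by exists (h^-1 * g) => //; rewrite mulVKg.
by apply/esym/lattice_of_eqP; rewrite /coset_rel mulKg.
Qed.

Lemma orbit_ofP S h g :
  orbit_of S (lattice_of h) (lattice_of g) <->
  exists k c, [/\ S k, integral_mx c & g = k * h * c].
Proof.
split=> [[k Sk]|[k [c [Sk cZ ->]]]].
  by rewrite act_lattice_of => /esym/lattice_of_mulZ[c cZ ->]; exists k, c.
by exists k => //; rewrite act_lattice_of; apply/esym/lattice_of_mulZ; exists c.
Qed.

Lemma lattice_of_continuous : continuous (@lattice_of R).
Proof. exact: pi_continuous. Qed.

Lemma lattice_of_open (U : set (SL3 R)) : open U -> open (@lattice_of R @` U).
Proof.
move=> oU; suff : open (@lattice_of R @^-1` (@lattice_of R @` U)) by [].
rewrite openE => g [u Uu /esym/lattice_of_mulZ[c cZ gE]].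
have gc : (fun g' => g' * c^-1) @ g --> u.
  have -> : u = g * c^-1 by rewrite gE mulgK.
  apply: (@cvg_SL3M R _ (nbhs g) _ id (fun=> c^-1)); [exact: cvg_id|exact: cvg_cst].
have gU : nbhs g [set g' | U (g' * c^-1)] by apply: gc; exact: open_nbhs_nbhs.
apply: filterS gU => g' Ug'; exists (g' * c^-1) => //.
by apply/esym/lattice_of_mulZ; exists c; rewrite ?mulgVK.
Qed.

Lemma closure_orbit_cvg T (F : set_system T) (k c : T -> SL3 R) S h g :
  ProperFilter F ->
  (\forall t \near F, S (k t)) -> (\forall t \near F, integral_mx (c t)) ->
  (fun t => k t * h * c t) @ F --> g ->
  closure (orbit_of S (lattice_of h)) (lattice_of g).
Proof.
move=> FF Sk cZ kg B /lattice_of_continuous/kg /= FB.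
have [t [[Skt ctZ] Bt]] := filter_ex (filterI (filterI Sk cZ) FB).
by exists (lattice_of (k t * h * c t)); split=> //; apply/orbit_ofP; exists (k t), (c t).
Qed.

(** Openness of the projection to the space of lattices lifts an adherent
    point of an orbit to a limit in the group, corrected by integral matrices
    on the right; the limit may be taken along an ultrafilter, which makes
    extracting subsequences unnecessary. *)
Lemma closure_orbit_ultra S h g :
  closure (orbit_of S (lattice_of h)) (lattice_of g) ->
  exists F : set_system (SL3 R * SL3 R),
    [/\ UltraFilter F, \forall p \near F, S p.1,
        \forall p \near F, integral_mx p.2 &
        (fun p => p.1 * h * p.2) @ F --> g].
Proof.
move=> clg; pose E U := [set p : SL3 R * SL3 R |
  [/\ S p.1, integral_mx p.2 & U (p.1 * h * p.2)]].
have FF : ProperFilter (filter_from (nbhs g) E).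
  apply: filter_from_proper => [|U gU].
    apply: filter_from_filter => [|U V gU gV]; first by exists setT; exact: filterT.
    by exists (U `&` V) => [|p [? ? []]]; [exact: filterI|split; split].
  have [V [oV Vg] sVU] : exists2 V, open_nbhs g V & V `<=` U.
    by move: gU; rewrite nbhsE => -[V]; exists V.
  have /clg[_ [[k Sk <-] [v Vv]]] : nbhs (lattice_of g) (@lattice_of R @` V).
    by apply: open_nbhs_nbhs; split; [exact: lattice_of_open|exists g].
  rewrite act_lattice_of => /lattice_of_mulZ[c cZ vE].
  by exists (k, c); split=> //=; rewrite -vE; exact: sVU.
have [F [UF sF]] := ultraFilterLemma FF.
exists F; split=> // [||U gU]; apply: sF.
- by exists setT => [|p []]; first exact: filterT.
- by exists setT => [|p []]; first exact: filterT.
- by exists U => // p [].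
Qed.

End LatticeSpace.

(** * Matrices of size 3 and nilpotent matrices *)

Section ThreeByThree.
Variable R : comNzRingType.

Lemma ord3P (P : 'I_3 -> Prop) : P 0 -> P 1 -> P 2%R -> forall i, P i.
Proof.
move=> P0 P1 P2 [[|[|[|//]]] i3].
- by have -> : Ordinal i3 = 0 by apply: val_inj.
- by have -> : Ordinal i3 = 1 by apply: val_inj.
- by have -> : Ordinal i3 = 2%R by apply: val_inj.
Qed.

Lemma sum_ord3 (V : nmodType) (f : 'I_3 -> V) : \sum_i f i = f 0 + f 1 + f 2%R.
Proof.
rewrite !big_ord_recl big_ord0 addr0 addrA; congr (_ + f _ + f _).
all: exact: val_inj.
Qed.

Lemma prod_ord3 (f : 'I_3 -> R) : \prod_i f i = f 0 * f 1 * f 2%R.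
Proof.
rewrite !big_ord_recl big_ord0 mulr1 mulrA; congr (_ * f _ * f _).
all: exact: val_inj.
Qed.

Lemma det_mx33 (M : 'M[R]_3) : \det M =
  M 0 0 * (M 1 1 * M 2%R 2%R - M 1 2%R * M 2%R 1)
  - M 0 1 * (M 1 0 * M 2%R 2%R - M 1 2%R * M 2%R 0)
  + M 0 2%R * (M 1 0 * M 2%R 1 - M 1 1 * M 2%R 0).
Proof.
pose m (i j : nat) := M (inord i) (inord j).
have -> : M = \matrix_(i, j) m i j.
  by apply/matrixP => i j; rewrite mxE /m !inord_val.
rewrite (expand_det_row _ 0) sum_ord3 /cofactor !(expand_det_row _ 0).
rewrite !big_ord_recl !big_ord0 /cofactor !det_mx11 !mxE /=.
by rewrite /bump /=; ring.
Qed.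

End ThreeByThree.

Section SymmetricNilpotent.
Variables (R : realDomainType).

Lemma mulmx_tr_eq0 m n (M : 'M[R]_(m, n)) : M *m M^T = 0 -> M = 0.
Proof.
move=> /matrixP MM; apply/matrixP => i j; rewrite mxE; apply/eqP.
have := MM i i; rewrite !mxE => /eqP.
rewrite psumr_eq0 => [/allP/(_ j (mem_index_enum j))|k _]; rewrite mxE -expr2.
  by rewrite /= sqrf_eq0.
exact: sqr_ge0.
Qed.

Lemma symmetric_nilpotent_eq0 n (N : 'M[R]_n.+1) k :
  N^T = N -> N ^+ k = 0 -> N = 0.
Proof.
move=> Nsym Nk; have symX m : (N ^+ m)^T = N ^+ m.
  by elim: m => [|m IH]; rewrite ?expr0 ?trmx1 // [in RHS]exprSr exprS [LHS]trmx_mul IH Nsym.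
have : N ^+ (2 ^ k) = 0.
  by rewrite -(subnK (ltnW (ltn_expl k (isT : 1 < 2)%N))) exprD Nk mulr0.
elim: k {Nk} => [|k IH]; first by rewrite expn0 expr1.
rewrite expnS mulnC exprM expr2 => NN; apply: IH; apply: mulmx_tr_eq0.
by rewrite symX.
Qed.

(** If [N] is normal and nilpotent, then so is the symmetric matrix [N * N^T]. *)
Lemma normal_nilpotent_eq0 n (N : 'M[R]_n.+1) k :
  N * N^T = N^T * N -> N ^+ k = 0 -> N = 0.
Proof.
move=> Nnormal Nk; apply: mulmx_tr_eq0; apply: (@symmetric_nilpotent_eq0 _ _ k).
  by rewrite trmx_mul trmxK.
by rewrite -[_ *m _]/(N * N^T) exprMn_comm // Nk mul0r.
Qed.

End SymmetricNilpotent.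

(** * The block groups and their reductivity *)

Section BlockGroups.
Variable R : realType.
Local Open Scope group_scope.
Implicit Types (g h u : SL3 R) (i : 'I_3) (pos : bool).

(** The elements preserving both the line spanned by the i-th basis vector and
    the coordinate plane complementary to it, that is, a copy of GL_2 acting on
    that plane. With [pos], the subgroup of index 2 which does not reverse the
    line. *)
Definition block_group i pos : set (SL3 R) := [set g | exists l : R,
  [/\ val g *m delta_mx i (0 : 'I_1) = l *: delta_mx i 0,
      delta_mx (0 : 'I_1) i *m val g = l *: delta_mx 0 i & pos -> (0 < l)%R]].

Lemma SL3_col_eig_neq0 g i (l : R) :
  val g *m delta_mx i (0 : 'I_1) = l *: delta_mx i 0 -> l != 0%R.
Proof.
move=> gl; apply/eqP => l0.
have := mulKmx (SL3_unit g) (delta_mx i (0 : 'I_1)).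
rewrite gl l0 scale0r mulmx0 => /matrixP/(_ i 0).
by rewrite !mxE !eqxx => /eqP; rewrite eq_sym oner_eq0.
Qed.

Lemma SL3V_col h n (c : 'M[R]_(3, n)) (m : R) : m != 0%R ->
  val h *m c = m *: c -> val h^-1 *m c = m^-1 *: c.
Proof.
move=> m0 hc; rewrite -[c in LHS](scalerK m0) -hc -scalemxAr.
by rewrite mulKmx ?SL3_unit.
Qed.

Lemma SL3V_row h n (r : 'M[R]_(n, 3)) (m : R) : m != 0%R ->
  r *m val h = m *: r -> r *m val h^-1 = m^-1 *: r.
Proof.
move=> m0 hr; rewrite -[r in LHS](scalerK m0) -hr -scalemxAl.
by rewrite mulmxK ?SL3_unit.
Qed.

Lemma delta_col_mx m (M : 'M[R]_(3, m)) i j :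
  (delta_mx (0 : 'I_1) i *m M) 0 j = M i j.
Proof. by rewrite -rowE mxE. Qed.

Lemma mx_delta_row m (M : 'M[R]_(m, 3)) i j :
  (M *m delta_mx i (0 : 'I_1)) j 0 = M j i.
Proof. by rewrite -colE mxE. Qed.

Lemma block_groupI g i pos (l m : R) :
  val g *m delta_mx i (0 : 'I_1) = l *: delta_mx i 0 ->
  delta_mx (0 : 'I_1) i *m val g = m *: delta_mx 0 i -> (pos -> 0 < l)%R ->
  block_group i pos g.
Proof.
move=> gl gm lpos; exists l; split=> //.
suff -> : l = m by [].
have /matrixP/(_ i 0) := gl; have /matrixP/(_ 0 i) := gm.
by rewrite delta_col_mx mx_delta_row !mxE !eqxx !mulr1 => ->.
Qed.

Lemma block_group_subgroup i pos : subgroup (block_group i pos).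
Proof.
split=> [|g h [l [gl gl' lpos]] [m [hm hm' mpos]]].
  by exists 1%R; rewrite /= mul1mx mulmx1 !scale1r.
have m0 := SL3_col_eig_neq0 hm.
exists (l * m^-1)%R; split=> [||/[dup]/lpos l0 /mpos m0']; last first.
- by rewrite mulr_gt0 ?invr_gt0.
- by rewrite mulmxA gl' -scalemxAl (SL3V_row m0 hm') scalerA.
- by rewrite -mulmxA (SL3V_col m0 hm) -scalemxAr gl scalerA mulrC.
Qed.

Lemma block_group_falseE i :
  block_group i false =
  [set g : SL3 R | forall j, j != i -> (val g i j = 0)%R /\ (val g j i = 0)%R].
Proof.
apply/seteqP; split=> [g [l [gl gl' _]] j ji|g g0].
  have /matrixP/(_ 0 j) := gl'; have /matrixP/(_ j 0) := gl.
  by rewrite delta_col_mx mx_delta_row !mxE (negPf ji) andbF mulr0 => -> ->.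
apply: (@block_groupI g i false (val g i i) (val g i i)) => //.
  apply/matrixP => j k; rewrite ord1 mx_delta_row !mxE andbT.
  by have [->|/g0[_ ->]] := eqVneq j i; rewrite ?mulr1 ?mulr0.
apply/matrixP => k j; rewrite ord1 delta_col_mx !mxE.
by have [->|/g0[-> _]] := eqVneq j i; rewrite ?mulr1 ?mulr0.
Qed.

Lemma block_groupE i pos g :
  block_group i pos g <-> block_group i false g /\ (pos -> (0 < val g i i)%R).
Proof.
split=> [[l [gl gl' lpos]]|[[l [gl gl' _]] gpos]].
  split; first by exists l.
  by have /matrixP/(_ i 0) := gl; rewrite mx_delta_row !mxE !eqxx mulr1 => ->.
exists l; split=> // /gpos.
by have /matrixP/(_ i 0) := gl; rewrite mx_delta_row !mxE !eqxx mulr1 => ->.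
Qed.

Lemma A_block_group i pos : @A_group R `<=` block_group i pos.
Proof.
move=> g [/is_diag_mxP gd gpos]; apply/block_groupE; split=> // .
rewrite block_group_falseE => j ji; split; apply: gd => //.
by rewrite eq_sym.
Qed.

Lemma block_group_zariski_closed i : zariski_closed (block_group i false).
Proof.
pose X k : mpoly.mpoly (3 * 3) R := mpoly.mpolyX R (mpoly.mnm1 k).
exists [set p | exists2 j, j != i &
  p = X (mxvec_index i j) \/ p = X (mxvec_index j i)].
have XE g j k : mpoly.meval (fun l => mxvec (val g) ord0 l) (X (mxvec_index j k))
    = val g j k.
  by rewrite mpoly.mevalXU mxvecE.
rewrite block_group_falseE; apply/seteqP; split=> g /= g0.
  by move=> p [j /g0[ij ji] []->]; rewrite XE.
by move=> j ji; split; rewrite -XE; apply: g0; exists j; auto.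
Qed.

(** The rotation by a quarter turn of the plane complementary to the i-th axis;
    indices are read modulo 3. *)
Definition quarter_turn_mx i : 'M[R]_3 :=
  delta_mx i i + delta_mx (i + 1)%R (i + 2)%R - delta_mx (i + 2)%R (i + 1)%R.

Fact quarter_turn_det i : \det (quarter_turn_mx i) == 1%R.
Proof.
apply/eqP; rewrite det_mx33 !mxE.
by elim/ord3P: i => /=; ring.
Qed.

Definition quarter_turn i : SL3 R := Sub (quarter_turn_mx i) (quarter_turn_det i).

Lemma quarter_turn_in i pos : block_group i pos (quarter_turn i).
Proof.
apply/block_groupE; rewrite block_group_falseE.
split=> [j|_] /=; last by rewrite !mxE; elim/ord3P: i => /=; lra.
by rewrite !mxE; elim/ord3P: i; elim/ord3P: j => //= _; split; lra.
Qed.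

Lemma quarter_turn_notin i j pos : i != j -> ~ block_group j pos (quarter_turn i).
Proof.
(* the third index is [- (i + j)], as 0 + 1 + 2 = 0 modulo 3 *)
move=> ij /block_groupE[]; rewrite block_group_falseE => /(_ (- (i + j))%R) + _.
move: ij; rewrite /= !mxE.
elim/ord3P: i; elim/ord3P: j => //= _ /(_ isT)[] /eqP; rewrite ?subr0 ?add0r.
all: by rewrite ?oppr_eq0 oner_eq0.
Qed.

(** On the plane this is the identity [B^T J B = det B J] of 2 x 2 matrices, with
    [J] the quarter turn. *)
Lemma quarter_turn_congr i (M : 'M[R]_3) : \det M = 1%R -> M i i = 1%R ->
  (forall j, j != i -> M i j = 0%R /\ M j i = 0%R) ->
  M^T *m quarter_turn_mx i *m M = quarter_turn_mx i.
Proof.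
rewrite det_mx33 => dM Mii M0.
have simp := (mul0r, mulr0, mul1r, mulr1, add0r, addr0, subr0).
apply/matrixP => p q; rewrite !mxE sum_ord3 !mxE !sum_ord3 !mxE.
move: Mii M0; elim/ord3P: i => Mii M0.
- have [a b] := M0 1%R isT; have [c d] := M0 2%R isT.
  move: dM; rewrite Mii a b c d; elim/ord3P: p; elim/ord3P: q => /= dM;
    by rewrite ?Mii ?a ?b ?c ?d ?simp //; lra.
- have [a b] := M0 0%R isT; have [c d] := M0 2%R isT.
  move: dM; rewrite Mii a b c d; elim/ord3P: p; elim/ord3P: q => /= dM;
    by rewrite ?Mii ?a ?b ?c ?d ?simp //; lra.
- have [a b] := M0 0%R isT; have [c d] := M0 1%R isT.
  move: dM; rewrite Mii a b c d; elim/ord3P: p; elim/ord3P: q => /= dM;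
    by rewrite ?Mii ?a ?b ?c ?d ?simp //; lra.
Qed.

Lemma quarter_turn_tr i u : block_group i false u -> val u i i = 1%R ->
  val (quarter_turn i * u^-1 * (quarter_turn i)^-1) = (val u)^T.
Proof.
rewrite block_group_falseE => uH ui /=.
have uwu := quarter_turn_congr (SL3_det u) ui uH.
rewrite -[X in X *m invmx (val u)]uwu mulmxK ?SL3_unit //.
by rewrite (mulmxK (SL3_unit (quarter_turn i))).
Qed.

(** A normal subgroup contains with [u] also the transpose of [u], which is
    conjugate to the inverse of [u]. If it consists of unipotent elements, then
    the symmetric element [u * u^T] is unipotent, hence trivial, and [u] is both
    orthogonal and unipotent. *)
Lemma block_group_unipotent_radical i :
  trivial_unipotent_radical (block_group i false).
Proof.
move=> U [U1 UV] _ _ [sUH nUH] Uunip; apply/seteqP; split=> [u Uu|u ->//].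
have uni l v : U v -> val v *m delta_mx i (0 : 'I_1) = l *: delta_mx i 0 -> l = 1%R.
  move=> /Uunip[n vn] vl; have powE m : (val v - 1%:M) ^+ m *m delta_mx i (0 : 'I_1)
      = (l - 1) ^+ m *: delta_mx i 0 :> 'cV[R]_3.
    elim: m => [|m IH]; first by rewrite !expr0 mul1mx scale1r.
    rewrite exprSr -mulmxA mulmxBl vl mul1mx -[X in _ *: _ - X]scale1r -scalerBl.
    by rewrite -scalemxAr IH scalerA -exprS.
  have := powE n; rewrite vn mul0mx => /matrixP/(_ i 0).
  rewrite !mxE !eqxx mulr1 => /eqP; rewrite eq_sym expf_eq0 subr_eq0.
  by case/andP => _ /eqP.
have [l [ul ul' _]] := sUH u Uu.
have l1 := uni l u Uu ul.
have uii : val u i i = 1%R.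
  by have /matrixP/(_ i 0) := ul; rewrite mx_delta_row !mxE !eqxx l1 mulr1.
pose w := quarter_turn i.
have UV1 v : U v -> U v^-1 by move=> Uv; have := UV 1 v U1 Uv; rewrite mul1g.
have Utr : U (w * u^-1 * w^-1).
  by apply: nUH; [exact: quarter_turn_in|exact: UV1].
have Uuut : U (u * (w * u^-1 * w^-1)) by rewrite -[X in _ * X]invgK; apply/UV/UV1.
have uut : val u *m (val u)^T = 1%:M.
  have [n] := Uunip _ Uuut.
  rewrite -[val (u * _)]/(val u *m val (w * u^-1 * w^-1)) quarter_turn_tr //; last exact: sUH.
  move=> /symmetric_nilpotent_eq0 uut; apply/subr0_eq/uut.
  by rewrite linearB /= trmx1 trmx_mul trmxK.
have utu : (val u)^T *m val u = 1%:M by apply: mulmx1C.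
have [n un] := Uunip u Uu; apply/val_inj/subr0_eq => /=.
apply: normal_nilpotent_eq0 un.
rewrite linearB /= trmx1 -[LHS]/(_ *m _) -[RHS]/(_ *m _).
rewrite !mulmxBl !mulmxBr uut utu.
by rewrite !mul1mx !mulmx1 !opprB addrACA [RHS]addrACA; congr (_ + _); rewrite addrC.
Qed.

(** The subgroup preserving the direction of the axis is open in the full block
    group, and only the latter is Zariski closed. *)
Lemma block_group_reductive i pos : reductive (block_group i pos).
Proof.
split; first exact: block_group_subgroup.
exists (block_group i false); split.
- exact: block_group_subgroup.
- exact: block_group_zariski_closed.
- exact: block_group_unipotent_radical.
exists (if pos then [set g : SL3 R | (0 < val g i i)%R] else setT).
  case: pos; last exact: openT.
  rewrite openE => g /= gpos.
  have gi : (fun h : SL3 R => val h i i) @ g --> val g i i.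
    by apply: (@cvg_SL3_entry R _ (nbhs g) _ id); exact: cvg_id.
  have : nbhs g [set h : SL3 R | (0 < val h i i)%R] := cvgr_gt _ gi _ gpos.
  exact.
apply/seteqP; split=> g; first
  by move=> /block_groupE[gH]; case: pos => gpos; split=> //; exact: gpos.
by move=> [gpos gH]; apply/block_groupE; split=> //; case: pos gpos.
Qed.

End BlockGroups.

(** * Limits in block orbits *)

Section BlockLimits.
Variable R : realType.
Local Open Scope group_scope.
Implicit Types (g h b : SL3 R) (i : 'I_3) (pos : bool) (t : 'rV[R]_3).
Local Notation e i := (delta_mx i (0 : 'I_1) : 'cV[R]_3).
Local Notation er i := (delta_mx (0 : 'I_1) i : 'rV[R]_3).

Definition integral_up_to_scale t : Prop :=
  exists2 N : R, N != 0%R & N *: t \is a mxOver Num.int.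

(** A lattice base for which the i-th coordinate axis contains a primitive
    vector and the dual lattice contains a multiple of the i-th coordinate form,
    provided that [t] is proportional to an integral row. *)
Definition block_base i t b : Prop :=
  val b *m e i = e i /\ er i *m val b = t.

Section Limits.
Variables (T : Type) (F : set_system T) (G c : T -> SL3 R) (g : SL3 R).
Context {FF : ProperFilter F}.
Hypothesis Gg : G @ F --> g.
Hypothesis cZ : \forall p \near F, integral_mx (c p).

(** The coordinates of a vector on the i-th axis in the bases [G p] form a nonzero
    integral column, which excludes convergence to the zero vector. *)
Lemma col_limit (l : T -> R) (l0 : R) i :
  (\forall p \near F, val (G p) *m (val (c p)^-1 *m e i) = l p *: e i) ->
  l @ F --> l0 ->
  l0 != 0%R /\ \forall p \near F, val (c p)^-1 *m e i = l0 *: (val g^-1 *m e i).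
Proof.
move=> Gcl ll0.
have uE : \forall p \near F, val (c p)^-1 *m e i = l p *: (val (G p)^-1 *m e i).
  by apply: filterS Gcl => p pE; rewrite scalemxAr -pE mulKmx ?SL3_unit.
have ul : (fun p => val (c p)^-1 *m e i) @ F --> l0 *: (val g^-1 *m e i).
  apply: cvg_trans (_ : (fun p => l p *: (val (G p)^-1 *m e i)) @ F --> _).
    by apply: near_eq_cvg; apply: filterS uE => p ->.
  have /cvg_mxP Gu : (fun p => val (G p)^-1 *m e i) @ F --> val g^-1 *m e i.
    apply: cvg_mulmx; last exact: cvg_cst.
    exact: (cvg_SL3P _ _).1 (cvg_SL3V Gg).
  apply/cvg_mxP => j k; rewrite mxE; under eq_cvg do rewrite mxE.
  exact: cvgM.
have uZ : \forall p \near F, val (c p)^-1 *m e i \is a mxOver Num.int.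
  apply: filterS cZ => p /integral_mxV pZ; apply: mxOverM => //.
  by apply/mxOverP => j k; rewrite mxE rpred_nat.
have uc := int_mx_cvg_eventually (FF := FF) uZ ul; split=> //.
apply/eqP => l00; have [p] := filter_ex uc; rewrite l00 scale0r => u0.
have := SL3_unit (c p)^-1 => /mulKmx/(_ (e i)); rewrite u0 mulmx0.
by move=> /matrixP/(_ i 0); rewrite !mxE !eqxx => /eqP; rewrite eq_sym oner_eq0.
Qed.

(** The dual counterpart, for linear forms integral up to scale; here [r p] is the
    form that has the coordinates [t *m val (c p)] in the basis [G p]. *)
Lemma row_limit (r : T -> 'rV[R]_3) (r0 : 'rV[R]_3) t :
  integral_up_to_scale t -> (\forall p \near F, r p *m val (G p) = t *m val (c p)) ->
  r @ F --> r0 -> \forall p \near F, t *m val (c p) = r0 *m val g.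
Proof.
move=> [N N0 NtZ] rE rr0.
have NtcZ : \forall p \near F, N *: (t *m val (c p)) \is a mxOver Num.int.
  by apply: filterS cZ => p pZ; rewrite scalemxAl; apply: mxOverM.
have Ntc : (fun p => N *: (t *m val (c p))) @ F --> N *: (r0 *m val g).
  apply: cvg_trans (_ : (fun p => N *: (r p *m val (G p))) @ F --> _).
    by apply: near_eq_cvg; apply: filterS rE => p ->.
  have /cvg_mxP rG : (fun p => r p *m val (G p)) @ F --> r0 *m val g.
    by apply: cvg_mulmx => //; exact: (cvg_SL3P _ _).1 Gg.
  apply/cvg_mxP => j k; rewrite mxE; under eq_cvg do rewrite mxE.
  by apply: cvgM => //; exact: cvg_cst.
have := int_mx_cvg_eventually (FF := FF) NtcZ Ntc.
by apply: filterS => p /(scalerI N0).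
Qed.

Lemma row_limit_neq0 (r : T -> 'rV[R]_3) t : t != 0%R ->
  integral_up_to_scale t -> (\forall p \near F, r p *m val (G p) = t *m val (c p)) ->
  ~ r @ F --> (0 : 'rV[R]_3)%R.
Proof.
move=> t0 tQ rE r0; have [p] := filter_ex (row_limit tQ rE r0).
rewrite mul0mx => tc0; move/eqP: t0; apply.
by rewrite -[t](mulmxK (SL3_unit (c p))) tc0 mul0mx.
Qed.

(** The coordinates of the limit vector and of the limit form are those of the
    axis and of the form [t] of the model [b], up to a common integral matrix.
    Undoing this matrix turns the limit into [k * b] with [k] in the block group. *)
Lemma block_limit (l : T -> R) (l0 m0 : R) (r : T -> 'rV[R]_3) i pos t b :
  integral_up_to_scale t -> block_base i t b ->
  (\forall p \near F, val (G p) *m (val (c p)^-1 *m e i) = l p *: e i) ->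
  l @ F --> l0 -> (pos -> (0 < l0)%R) ->
  (\forall p \near F, r p *m val (G p) = t *m val (c p)) ->
  r @ F --> m0 *: er i ->
  orbit_of (block_group i pos) (lattice_of b) (lattice_of g).
Proof.
move=> tQ [be bt] Gcl ll0 l0pos rE rm0.
have [l00 uc] := col_limit Gcl ll0; have tc := row_limit tQ rE rm0.
have [p [pZ [pu pt]]] := filter_ex (filterI cZ (filterI uc tc)).
apply/orbit_ofP; exists (g * (c p)^-1 * b^-1), (c p); split=> //; last first.
  by rewrite -!mulgA mulKg mulVg mulg1.
have be' : val b^-1 *m e i = e i.
  by rewrite -[X in _ *m X]be mulKmx ?SL3_unit.
have ke : val (g * (c p)^-1 * b^-1) *m e i = l0 *: e i.
  rewrite -[val _]/(val g *m val (c p)^-1 *m val b^-1) -!mulmxA be' pu -scalemxAr.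
  by rewrite mulKVmx ?SL3_unit.
have ek : (m0 *: er i) *m val (g * (c p)^-1 * b^-1) = er i.
  rewrite -[val _]/(val g *m val (c p)^-1 *m val b^-1) !mulmxA -pt.
  by rewrite mulmxK ?SL3_unit // -bt mulmxK ?SL3_unit.
have m00 : m0 != 0%R.
  apply/eqP => m00; move: ek; rewrite m00 scale0r mul0mx => /matrixP/(_ 0 i).
  by rewrite !mxE !eqxx => /eqP; rewrite eq_sym oner_eq0.
apply: (@block_groupI _ _ i pos l0 m0^-1) => //.
by rewrite -[in RHS]ek -scalemxAl scalerK.
Qed.

End Limits.

Lemma block_base_neq0 i t b : block_base i t b -> t != 0%R.
Proof.
move=> [be bt]; apply/eqP => t0.
move: bt; rewrite t0 => /(congr1 (mulmx^~ (e i))); rewrite -mulmxA be mul0mx.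
by move=> /matrixP/(_ 0 0); rewrite mx_delta_row !mxE !eqxx => /eqP; rewrite oner_eq0.
Qed.

(** For [k] in the block group with i-th diagonal entry [l], the lattice of
    [k * b] has the vector [l *: e i] and the rational form [l^-1 *: er i]. If [l]
    were unbounded, then the form would tend to 0. *)
Lemma block_orbit_closed i pos t b :
  integral_up_to_scale t -> block_base i t b ->
  closed (orbit_of (block_group i pos) (lattice_of b)).
Proof.
move=> tQ bb y; rewrite -[y]lattice_of_repr; move: (repr y) => g {y}.
move=> /closure_orbit_ultra[F [UF kH cZ Gg]].
pose G p : SL3 R := p.1 * b * p.2; pose l (p : SL3 R * SL3 R) := val p.1 i i.
have kl : \forall p \near F, [/\ val p.1 *m e i = l p *: e i,
    er i *m val p.1 = l p *: er i, l p != 0%R & pos -> (0 < l p)%R].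
  apply: filterS kH => p [m [pm pm' mpos]].
  have lE : l p = m.
    by have /matrixP/(_ i 0) := pm; rewrite mx_delta_row !mxE !eqxx mulr1.
  by rewrite lE; split=> //; exact: SL3_col_eig_neq0 pm.
have Gcl : \forall p \near F, val (G p) *m (val p.2^-1 *m e i) = l p *: e i.
  apply: filterS kl => p [pl _ _ _].
  rewrite -[val (G p)]/(val p.1 *m val b *m val p.2) -!mulmxA.
  by rewrite mulKVmx ?SL3_unit // bb.1 pl.
pose r p := (l p)^-1 *: er i.
have rG : \forall p \near F, r p *m val (G p) = t *m val p.2.
  apply: filterS kl => p [_ pl l0 _].
  rewrite -[val (G p)]/(val p.1 *m val b *m val p.2) !mulmxA -scalemxAl pl.
  by rewrite scalerK // bb.2.
have rcvg (m : R) : (fun p => (l p)^-1%R) @ F --> m -> r @ F --> m *: er i.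
  move=> lm; apply/cvg_mxP => j k; rewrite mxE; under eq_cvg do rewrite mxE.
  by apply: cvgM => //; exact: cvg_cst.
have [[l0 ll0]|linv] := ultra_cvg_or_inv0 l; last first.
  have [] := row_limit_neq0 Gg cZ (block_base_neq0 bb) tQ rG.
  by rewrite -[0%R](scale0r (er i)); exact: rcvg.
have [l00 _] := col_limit Gg cZ Gcl ll0.
apply: (block_limit Gg cZ tQ bb Gcl ll0 _ rG (rcvg l0^-1%R _)); last exact: cvgV.
move=> pos1; rewrite lt_neqAle eq_sym l00 /=.
by apply: (cvgr_to_ge ll0); apply: filterS kl => p [_ _ _ /(_ pos1)/ltW].
Qed.

End BlockLimits.

(** * Orbit closures of the diagonal group *)

Section DiagonalOrbit.
Variable R : realType.
Local Open Scope group_scope.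
Implicit Types (a g h b : SL3 R) (i k : 'I_3).
Local Notation e i := (delta_mx i (0 : 'I_1) : 'cV[R]_3).
Local Notation er i := (delta_mx (0 : 'I_1) i : 'rV[R]_3).
Local Notation i1 := (1%R : 'I_3).
Local Notation i2 := (2%R : 'I_3).

Lemma A_groupP a : @A_group R a <->
  exists2 d : 'rV[R]_3, (forall i, (0 < d 0 i)%R) & val a = diag_mx d.
Proof.
split=> [[/is_diag_mxP ad apos]|[d dpos aE]].
  exists (\row_i val a i i) => [i|]; first by rewrite mxE.
  apply/matrixP => i j; rewrite !mxE; have [->|/ad->] := eqVneq i j => //.
split; first by rewrite aE diag_mx_is_diag.
by move=> i; rewrite aE mxE eqxx mulr1n.
Qed.

Lemma A_group_of (d : 'rV[R]_3) : (forall i, (0 < d 0 i)%R) ->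
  (d 0 0 * d 0 i1 * d 0 i2)%R = 1%R -> exists2 a, @A_group R a & val a = diag_mx d.
Proof.
move=> dpos d1; have da : \det (diag_mx d) == 1%R.
  by rewrite det_diag prod_ord3 d1.
by exists (Sub (diag_mx d) da : SL3 R) => //; apply/A_groupP; exists d.
Qed.

Lemma A_group_prod a : @A_group R a -> (val a 0 0 * val a i1 i1 * val a i2 i2)%R = 1%R.
Proof.
move=> /A_groupP[d _ aE]; have := SL3_det a; rewrite aE det_diag.
rewrite prod_ord3 => <-.
by rewrite !mxE !eqxx !mulr1n.
Qed.

Lemma A_group_neq0 a i : @A_group R a -> val a i i != 0%R.
Proof. by move=> [_ apos]; rewrite gt_eqF. Qed.

Lemma geometric3_inj (v : R) : (1 < v)%R ->
  injective (fun i : 'I_3 => if i == 0 then v else if i == i1 then 1 else v^-1)%R.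
Proof.
move=> v1 j k; have vV : (v^-1 < 1)%R by rewrite invf_lt1 // (lt_trans _ v1).
by elim/ord3P: j; elim/ord3P: k => //= E; exfalso; lra.
Qed.

(** A lattice [h] in which every coordinate axis but the first contains a
    primitive vector, and on which a linear form [s] takes rational values, where
    [s] vanishes on the first axis and on no other. The entries of [b] are models
    of the limits along unbounded diagonal elements. *)
Variables (h : SL3 R) (s : 'rV[R]_3) (b : 'I_3 -> SL3 R).
Hypothesis h_col : forall i, i != 0%R -> val h *m e i = e i.
Hypothesis s0 : s 0 0 = 0%R.
Hypothesis s_neq0 : forall i, i != 0%R -> s 0 i != 0%R.
Hypothesis sh_rat : forall i, i != 0%R -> integral_up_to_scale ((s 0 i)^-1 *: (s *m val h)).
Hypothesis b_base : forall i, i != 0%R ->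
  block_base i ((s 0 i)^-1 *: (s *m val h)) (b i).

Section Limits.
Variables (T : Type) (F : set_system T) (a c : T -> SL3 R) (g : SL3 R).
Context {FF : ProperFilter F}.
Hypothesis aA : \forall p \near F, @A_group R (a p).
Hypothesis cZ : \forall p \near F, integral_mx (c p).
Hypothesis ahc : (fun p => a p * h * c p) @ F --> g.

Let G p := a p * h * c p.
(* The form [s] transported by [a p], normalised as in the model [b i]. *)
Let r i p : 'rV[R]_3 := (s 0 i)^-1 *: \row_k (s 0 k / val (a p) k k)%R.

Local Lemma diag_col i : i != 0%R ->
  \forall p \near F, val (G p) *m (val (c p)^-1 *m e i) = val (a p) i i *: e i.
Proof.
move=> i0; apply: filterS aA => p /A_groupP[d _ aE].
rewrite -[val (G p)]/(val (a p) *m val h *m val (c p)) -!mulmxA.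
rewrite (mulKVmx (SL3_unit _)) h_col // aE; apply/matrixP => j k.
rewrite ord1 mx_delta_row !mxE eqxx andbT.
by have [->|ji] := eqVneq j i; rewrite ?mulr1n ?mulr1 ?mulr0n ?mulr0.
Qed.

Local Lemma diag_row i : i != 0%R ->
  \forall p \near F, r i p *m val (G p) = ((s 0 i)^-1 *: (s *m val h)) *m val (c p).
Proof.
move=> i0; apply: filterS aA => p aAp; have [d dpos aE] := (A_groupP _).1 aAp.
rewrite -[val (G p)]/(val (a p) *m val h *m val (c p)) !mulmxA /r.
rewrite -!scalemxAl; congr (_ *: (_ *m _ *m _)).
apply/matrixP => j k; rewrite ord1 aE mul_mx_diag !mxE eqxx mulr1n divfK //.
by rewrite gt_eqF.
Qed.

Local Lemma diag_row_cvg i k (l : R) :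
  (k != 0%R -> (fun p => (val (a p) k k)^-1%R) @ F --> l) ->
  (fun p => r i p 0 k) @ F --> ((s 0 i)^-1 * (s 0 k * l))%R.
Proof.
move=> al; have -> : (fun p => r i p 0 k) =
    (fun p => (s 0 i)^-1 * (s 0 k * (val (a p) k k)^-1))%R.
  by apply/funext => p; rewrite !mxE.
apply: cvgM; first exact: cvg_cst.
have [->|/al akl] := eqVneq k 0.
  rewrite s0 mul0r; under eq_fun do rewrite mul0r.
  exact: cvg_cst.
by apply: cvgM; first exact: cvg_cst.
Qed.

(** When [a p] is unbounded along the axis other than the first and the i-th, the
    plane where [s] vanishes tends to the coordinate plane complementary to the
    i-th axis. *)
Lemma diag_limit_block (l0 : R) i pos : i != 0%R ->
  (fun p => val (a p) i i) @ F --> l0 ->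
  (forall k, k != 0%R -> k != i -> (fun p => (val (a p) k k)^-1%R) @ F --> 0%R) ->
  orbit_of (block_group i pos) (lattice_of (b i)) (lattice_of g).
Proof.
move=> i0 al0 ainf; have [l00 _] := col_limit ahc cZ (diag_col i0) al0.
have l0pos : (0 < l0)%R.
  rewrite lt_neqAle eq_sym l00 /=; apply: (cvgr_to_ge al0).
  by apply: filterS aA => p [_ /(_ i)/ltW].
apply: (block_limit ahc cZ (sh_rat i0) (b_base i0) (diag_col i0) al0 (fun=> l0pos)
  (diag_row i0) (m0 := l0^-1%R)).
apply/cvg_mxP => j k; rewrite ord1 !mxE eqxx /=.
have [->|ki] := eqVneq k i.
  rewrite mulr1 -[X in _ --> X](mulKf (s_neq0 i0)); apply: diag_row_cvg => _.
  exact: cvgV.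
rewrite mulr0 -(mulr0 (s 0 i)^-1%R) -(mulr0 (s 0 k)); apply: diag_row_cvg => k0.
exact: ainf.
Qed.

(** Otherwise the form [s] would tend to 0 while its coordinates are nonzero with
    bounded denominators. *)
Lemma diag_no_escape :
  ~ (forall k, k != 0%R -> (fun p => (val (a p) k k)^-1%R) @ F --> 0%R).
Proof.
move=> ainf; have n0 : i1 != 0%R by [].
apply: (row_limit_neq0 ahc cZ (block_base_neq0 (b_base n0)) (sh_rat n0) (diag_row n0)).
apply/cvg_mxP => j k; rewrite ord1 mxE.
by rewrite -(mulr0 (s 0 i1)^-1%R) -(mulr0 (s 0 k)); exact: diag_row_cvg (ainf k).
Qed.

(** The first diagonal entry is determined by the others, so the diagonal
    elements converge, and then so do the integral matrices. *)
Lemma diag_limit_bounded (l1 l2 : R) :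
  (fun p => val (a p) i1 i1) @ F --> l1 -> (fun p => val (a p) i2 i2) @ F --> l2 ->
  exists a0 c0, [/\ @A_group R a0, integral_mx c0, g = a0 * h * c0,
    a @ F --> a0 & \forall p \near F, c p = c0].
Proof.
move=> al1 al2.
have lim_pos i (l : R) : i != 0%R -> (fun p => val (a p) i i) @ F --> l -> (0 < l)%R.
  move=> i0 al; have [l0 _] := col_limit ahc cZ (diag_col i0) al.
  rewrite lt_neqAle eq_sym l0 /=; apply: (cvgr_to_ge al).
  by apply: filterS aA => p [_ /(_ i)/ltW].
have l1pos := lim_pos 1%R l1 isT al1; have l2pos := lim_pos 2%R l2 isT al2.
pose d : 'rV[R]_3 := \row_i (if i == 0 then (l1 * l2)^-1 else if i == i1 then l1 else l2)%R.
have l12 : (l1 * l2 != 0)%R by rewrite mulf_neq0 ?gt_eqF.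
have [a0 a0A a0E] : exists2 a0, @A_group R a0 & val a0 = diag_mx d.
  apply: A_group_of => [i|].
    by elim/ord3P: i; rewrite !mxE //= invr_gt0 mulr_gt0.
  by rewrite !mxE /= -mulrA mulVf.
have aa0 : a @ F --> a0.
  apply/cvg_SL3P; rewrite a0E; apply/cvg_mxP => i j; rewrite !mxE.
  have [<-|ij] := eqVneq i j; last first.
    apply: cvg_near_cst; apply: filterS aA => p [/is_diag_mxP ad _].
    by rewrite ad // mulr0n.
  rewrite mulr1n; elim/ord3P: i {j} => //=.
  apply: cvg_trans (_ : (fun p => (val (a p) i1 i1 * val (a p) i2 i2)^-1%R) @ F --> _).
    apply: near_eq_cvg; apply: filterS aA => p aAp.
    have := A_group_prod aAp; rewrite -mulrA => ap.
    have nz : (val (a p) i1 i1 * val (a p) i2 i2)%R != 0%R.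
      by rewrite mulf_neq0 ?A_group_neq0.
    by apply: (mulIf nz); rewrite ap mulVf.
  by apply: cvgV => //; exact: cvgM.
have cc : c @ F --> (a0 * h)^-1 * g.
  have cE : c = (fun p => (a p * h)^-1 * G p).
    by apply/funext => p; rewrite /G mulKg.
  rewrite [X in X @ _]cE; apply: cvg_SL3M => //; apply: cvg_SL3V.
  by apply: cvg_SL3M => //; exact: cvg_cst.
have cval : (fun p => val (c p)) @ F --> val ((a0 * h)^-1 * g).
  exact: (cvg_SL3P _ _).1 cc.
have cE : \forall p \near F, c p = (a0 * h)^-1 * g.
  have := int_mx_cvg_eventually (FF := FF) cZ cval.
  by apply: filterS => p; exact: val_inj.
exists a0, ((a0 * h)^-1 * g); split=> //; last by rewrite mulVKg.
by have [p [pZ <-]] := filter_ex (filterI cZ cE).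
Qed.

End Limits.

(** Along an ultrafilter, each of the last two diagonal entries converges or tends
    to infinity, which leaves the cases treated above. *)
Lemma diag_limit T (F : set_system T) (a c : T -> SL3 R) (g : SL3 R) :
  UltraFilter F ->
  (\forall p \near F, @A_group R (a p)) -> (\forall p \near F, integral_mx (c p)) ->
  (fun p => a p * h * c p) @ F --> g ->
  (exists a0 c0, [/\ @A_group R a0, integral_mx c0, g = a0 * h * c0,
    a @ F --> a0 & \forall p \near F, c p = c0]) \/
  exists2 i, i != 0%R & forall pos,
    orbit_of (block_group i pos) (lattice_of (b i)) (lattice_of g).
Proof.
move=> UF aA cZ ahc.
have [[l1 al1]|inv1] := ultra_cvg_or_inv0 (fun p => val (a p) i1 i1);
  have [[l2 al2]|inv2] := ultra_cvg_or_inv0 (fun p => val (a p) i2 i2).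
- by left; exact: (diag_limit_bounded aA cZ ahc al1 al2).
- right; exists i1 => // pos; apply: (diag_limit_block aA cZ ahc pos _ al1) => //.
  by elim/ord3P.
- right; exists i2 => // pos; apply: (diag_limit_block aA cZ ahc pos _ al2) => //.
  by elim/ord3P.
- by case: (diag_no_escape aA cZ ahc); elim/ord3P.
Qed.

Lemma closure_diag_orbit :
  closure (orbit_of (@A_group R) (lattice_of h)) `<=`
  orbit_of (@A_group R) (lattice_of h) `|`
  (\bigcup_(i in [set i | i != 0%R])
     \bigcap_pos orbit_of (@block_group R i pos) (lattice_of (b i))).
Proof.
move=> y; rewrite -[y]lattice_of_repr; move: (repr y) => g {y}.
move=> /closure_orbit_ultra[F [UF aA cZ Gg]].
have [[a0 [c0 [a0A c0Z gE _ _]]]|[i i0 gi]] := diag_limit UF aA cZ Gg.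
  by left; apply/orbit_ofP; exists a0, c0.
by right; exists i => // pos _; exact: gi.
Qed.

(** Up to scaling, the i-th coordinate form is integral on the lattice of [g] and
    the i-th axis is spanned by a lattice vector. *)
Definition axis_splits g i : Prop :=
  (exists (m : R) (u : 'rV[R]_3), u \is a mxOver Num.int /\ er i *m val g = m *: u) /\
  (exists (m : R) (u : 'cV[R]_3), u \is a mxOver Num.int /\ val g^-1 *m e i = m *: u).

(** A point of a block orbit splits along the axis of the block group; a monomial
    matrix [l] only permutes the axes and rescales them. *)
Lemma block_orbit_splits (l g b' : SL3 R) t i j pos (m m' : R) :
  integral_up_to_scale t -> block_base i t b' ->
  er i *m val l = m *: er j -> val l *m e j = m' *: e i ->
  orbit_of (block_group i pos) (lattice_of b') (lattice_of (l * g)) ->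
  axis_splits g j.
Proof.
move=> [N N0 NtZ] [be bt] lr lc /orbit_ofP[k [c [[n [kc kr _]] cZ lgE]]].
have n0 := SL3_col_eig_neq0 kc.
have {}lgE : val l *m val g = val k *m val b' *m val c := congr1 val lgE.
have m0 : m != 0%R.
  apply/eqP => m0; have := mulmxK (SL3_unit l) (er i).
  rewrite lr m0 scale0r mul0mx => /matrixP/(_ 0 i).
  by rewrite !mxE !eqxx => /eqP; rewrite eq_sym oner_eq0.
split.
  exists (m^-1 * (n * N^-1))%R, ((N *: t) *m val c); split; first exact: mxOverM.
  have rE : m *: (er j *m val g) = n *: (t *m val c).
    by rewrite scalemxAl -lr -mulmxA lgE !mulmxA kr -!scalemxAl bt.
  by rewrite -scalemxAl scalerA -!mulrA mulVf // mulr1 -scalerA -rE scalerK.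
exists (n^-1 * m')%R, (val c^-1 *m e i); split.
  apply: mxOverM; first exact: integral_mxV.
  by apply/mxOverP => ? ?; rewrite mxE rpred_nat.
have lE : m' *: (val l^-1 *m e i) = e j.
  by rewrite scalemxAr -lc (mulKmx (SL3_unit l)).
have cE : m' *: (val g *m (val c^-1 *m e i)) = n *: e j.
  rewrite -lE scalerA mulrC -scalerA; congr (_ *: _).
  rewrite scalemxAr -kc -[LHS](mulKmx (SL3_unit l)) [val l *m _]mulmxA lgE.
  by rewrite -!mulmxA (mulKVmx (SL3_unit c)) be.
rewrite -scalerA -[X in _ = _ *: (_ *: X)](mulKmx (SL3_unit g)).
by rewrite [m' *: _]scalemxAr cE -scalemxAr scalerK.
Qed.

(** The integral matrix [c0] is conjugate to the inverse of [a0] and has common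
    eigenvectors with it, so the positive entries of [a0] and their inverses are
    integers. *)
Lemma diag_stabilizer a0 c0 :
  @A_group R a0 -> integral_mx c0 -> h = a0 * h * c0 -> a0 = 1 /\ c0 = 1.
Proof.
move=> a0A c0Z hE; have [d dpos a0E] := (A_groupP _).1 a0A.
have a0e i : val a0 *m e i = d 0 i *: e i.
  rewrite a0E; apply/matrixP => j k; rewrite ord1 mx_delta_row !mxE eqxx andbT.
  by have [->|ji] := eqVneq j i; rewrite ?mulr1n ?mulr1 ?mulr0n ?mulr0.
have d1 i : i != 0%R -> d 0 i = 1%R.
  move=> i0; have he : val h^-1 *m e i = e i.
    by rewrite -[X in _ *m X](h_col i0) (mulKmx (SL3_unit h)).
  have cVe : val c0^-1 *m e i = d 0 i *: e i.
    have -> : c0^-1 = h^-1 * a0 * h.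
      by apply: (mulIg c0); rewrite mulVg -!mulgA [a0 * _]mulgA -hE mulVg.
    rewrite -[val _]/(val h^-1 *m val a0 *m val h) -!mulmxA h_col // a0e.
    by rewrite -scalemxAr he.
  have ce : val c0 *m e i = (d 0 i)^-1 *: e i.
    by rewrite -[X in val X](invgK c0); apply: SL3V_col => //; rewrite gt_eqF.
  have dZ : d 0 i \is a Num.int.
    have /mxOverP/(_ i i) := integral_mxV c0Z.
    by have /matrixP/(_ i 0) := cVe; rewrite mx_delta_row !mxE !eqxx mulr1 => ->.
  have dVZ : (d 0 i)^-1%R \is a Num.int.
    have /mxOverP/(_ i i) := c0Z.
    by have /matrixP/(_ i 0) := ce; rewrite mx_delta_row !mxE !eqxx mulr1 => ->.
  have := norm_intr_ge1 dZ; have := norm_intr_ge1 dVZ.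
  rewrite !gtr0_norm ?invr_gt0 // invr_eq0 gt_eqF // => /(_ isT) d1 /(_ isT) d1'.
  apply/eqP; rewrite eq_le d1' andbT.
  by move: d1; rewrite -[X in (X <= _)%R]invr1 lef_pV2 ?posrE.
have a01 : a0 = 1.
  apply: val_inj; rewrite a0E.
  have d00 : d 0 0 = 1%R.
    by have := A_group_prod a0A; rewrite a0E !mxE !eqxx !mulr1n (d1 i1) // (d1 i2) // !mulr1.
  apply/matrixP => i j; rewrite !mxE; congr (_ *+ _).
  by elim/ord3P: i; rewrite // d1.
by split=> //; apply: (mulgI h); rewrite mulg1 [RHS]hE a01 mul1g.
Qed.

(** Conjugation by [l] permutes the lines spanned by the basis vectors, as these are
    the eigenlines of a diagonal matrix with distinct entries. *)
Lemma commuting_diag_monomial a a' (l : SL3 R) i :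
  @A_group R a -> @A_group R a' -> (forall j k, val a j j = val a k k -> j = k) ->
  a * l = l * a' ->
  exists j m m', er i *m val l = m *: er j /\ val l *m e j = m' *: e i.
Proof.
move=> /A_groupP[d _ aE] /A_groupP[d' _ aE'] a_inj la.
have d_inj j k : d 0 j = d 0 k -> j = k.
  by move=> djk; apply: a_inj; rewrite aE !mxE !eqxx !mulr1n.
have {la}lE p q : (d 0 p * val l p q = val l p q * d' 0 q)%R.
  have := congr1 (fun x : SL3 R => val x p q) la.
  by rewrite /= aE aE' mul_diag_mx mul_mx_diag !mxE.
have [j lij] : exists j, val l i j != 0%R.
  apply: contrapT => /forallNP l0; have := mulmxK (SL3_unit l) (er i).
  have -> : er i *m val l = 0%R.
    by apply/matrixP => p q; rewrite ord1 delta_col_mx mxE; have /negP/negPn/eqP := l0 q.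
  rewrite mul0mx => /matrixP/(_ 0 i).
  by rewrite !mxE !eqxx => /eqP; rewrite eq_sym oner_eq0.
have col_l q : val l i q != 0%R -> forall p, p != i -> val l p q = 0%R.
  move=> liq p pi; apply/eqP; apply: contraNT pi => lpq.
  apply/eqP/d_inj; apply: (mulIf lpq); rewrite lE.
  by rewrite mulrC; congr (_ * _)%R; apply: (mulfI liq); rewrite -lE mulrC.
have col_e q : val l i q != 0%R -> val l *m e q = val l i q *: e i.
  move=> liq; apply/matrixP => p k; rewrite ord1 mx_delta_row !mxE eqxx andbT.
  have [->|/(col_l q liq)->] := eqVneq p i; rewrite ?mulr1 ?mulr0 //.
exists j, (val l i j), (val l i j); split; last exact: col_e.
apply/matrixP => p q; rewrite ord1 delta_col_mx !mxE eqxx /=.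
have [->|qj] := eqVneq q j; first by rewrite mulr1.
rewrite mulr0; apply/eqP/negPn/negP => liq.
have : val l *m (val l i j *: e q - val l i q *: e j) = 0%R.
  by rewrite mulmxBr -!scalemxAr !col_e // !scalerA mulrC subrr.
move=> /(congr1 (mulmx (val l^-1))); rewrite (mulKmx (SL3_unit l)) mulmx0.
move=> /matrixP/(_ q 0); rewrite !mxE !eqxx (negPf qj) mulr1 mulr0 subr0.
by move/eqP: lij.
Qed.

Hypothesis h_splits : forall i, ~ axis_splits h i.

Lemma diag_orbit_block_disjoint i pos : i != 0%R ->
  orbit_of (@A_group R) (lattice_of h) `&`
  orbit_of (block_group i pos) (lattice_of (b i)) = set0.
Proof.
move=> i0; apply/seteqP; split=> // y [[a aA <-]]; rewrite act_lattice_of.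
have [d dpos aE] := (A_groupP _).1 aA.
move=> yi; apply: (@h_splits i).
apply: (block_orbit_splits (m := d 0 i) (m' := d 0 i) (sh_rat i0) (b_base i0) _ _ yi).
  rewrite aE; apply/matrixP => j k; rewrite ord1 delta_col_mx !mxE.
  by case: eqVneq => _; rewrite ?mulr1 ?mulr0.
rewrite aE; apply/matrixP => j k; rewrite ord1 mx_delta_row !mxE eqxx andbT.
by have [->|ji] := eqVneq j i; rewrite ?mulr1n ?mulr1 ?mulr0n ?mulr0.
Qed.

(** If the closure is the orbit of a group [L], then for [l] in [L] the conjugates
    by [l] of diagonal elements close to 1 move [h] within its diagonal orbit,
    because that orbit is open in its closure. As the stabiliser of [h] meets the
    diagonal group trivially, these conjugates are diagonal and [l] is monomial.
    This is impossible when [l] carries [h] to a block orbit. *)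
Lemma diag_orbit_irregular i : i != 0%R ->
  closure (orbit_of (@A_group R) (lattice_of h)) `&`
    orbit_of (block_group i true) (lattice_of (b i)) !=set0 ->
  irregular (lattice_of h).
Proof.
move=> i0 [y [cly yi]] [L [[L1 LV] _ AL clL]].
have LI g : L g -> L g^-1 by move=> Lg; have := LV 1 g L1 Lg; rewrite mul1g.
have LM g g' : L g -> L g' -> L (g * g').
  by move=> Lg /LI Lg'; have := LV g _ Lg Lg'; rewrite invgK.
move: cly; rewrite clL => -[l Ll lE].
have xF j pos : j != 0%R -> ~ orbit_of (block_group j pos) (lattice_of (b j)) (lattice_of h).
  move=> j0 hj; have := diag_orbit_block_disjoint pos j0.
  move=> /seteqP[/(_ (lattice_of h))+ _]; apply; split=> //.
  by exists 1; rewrite ?act_lattice_of ?mul1g //; apply/A_groupP; exists (const_mx 1%R);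
    [move=> k; rewrite mxE|rewrite /= -diag_const_mx].
(* diagonal elements with distinct entries tending to the identity *)
pose u (n : nat) : R := (1 + n.+1%:R^-1)%R.
have u1 n : (1 < u n)%R by rewrite ltrDl invr_gt0 ltr0n.
have u0 n : (0 < u n)%R by apply: lt_trans (u1 n).
have /choice[a aP] : forall n, exists a, @A_group R a /\
    val a = diag_mx (\row_i (if i == 0 then u n else if i == i1 then 1 else (u n)^-1))%R.
  move=> n; have [||a aA aE] := @A_group_of
    (\row_i (if i == 0 then u n else if i == i1 then 1 else (u n)^-1))%R.
  - by elim/ord3P; rewrite !mxE //= invr_gt0.
  - by rewrite !mxE /= mulr1 mulfV // gt_eqF.
  - by exists a.
have un1 : u @ \oo --> (1 : R)%R.
  rewrite -[X in _ --> X]addr0; apply: cvgD; first exact: cvg_cst.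
  exact: cvg_harmonic.
have aa : a @ \oo --> (1 : SL3 R).
  apply/cvg_SL3P/cvg_mxP => j k; rewrite mxE.
  have -> : (fun n => val (a n) j k) = (fun n =>
      (if j == 0 then u n else if j == i1 then 1 else (u n)^-1) *+ (j == k))%R.
    by apply/funext => n; rewrite (aP n).2 !mxE.
  have [_|_] := eqVneq j k; last by rewrite mulr0n; exact: cvg_cst.
  rewrite mulr1n; elim/ord3P: j => //=; first exact: cvg_cst.
  by rewrite -invr1; apply: cvgV => //; rewrite oner_eq0.
have [U [UU sU]] := ultraFilterLemma (@eventually_filter).
pose p n := l^-1 * a n * l * h.
have ph : p @ U --> h.
  have -> : h = l^-1 * 1 * l * h by rewrite mulg1 mulVg mul1g.
  apply: cvg_trans (_ : p @ \oo --> _); first by move=> B; exact: sU.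
  by do !(apply: cvg_SL3M => //); exact: cvg_cst.
have pA : \forall n \near U, orbit_of (@A_group R) (lattice_of h) (lattice_of (p n)).
  have notin j : j != 0%R -> \forall n \near U,
      ~ orbit_of (block_group j true) (lattice_of (b j)) (lattice_of (p n)).
    move=> j0; have oj : open (~` orbit_of (@block_group R j true) (lattice_of (b j))).
      by rewrite openC; exact: block_orbit_closed (sh_rat j0) (b_base j0).
    have /lattice_of_continuous : nbhs (lattice_of h)
        (~` orbit_of (@block_group R j true) (lattice_of (b j))).
      by apply: open_nbhs_nbhs; split=> //; exact: xF.
    exact: ph.
  have n1 := notin i1 isT; have n2 := notin i2 isT.
  apply: filterS (filterI n1 n2) => n [pn1 pn2].
  have : orbit_of L (lattice_of h) (lattice_of (p n)).
    exists (l^-1 * a n * l); last by rewrite act_lattice_of.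
    exact: LM (LM _ _ (LI _ Ll) (AL _ (aP n).1)) Ll.
  rewrite -clL => /closure_diag_orbit[//|[j /= j0 /(_ true I) /=]].
  by elim/ord3P: j j0.
have /choice[ac acP] : forall n, exists ac : SL3 R * SL3 R,
    orbit_of (@A_group R) (lattice_of h) (lattice_of (p n)) ->
    [/\ @A_group R ac.1, integral_mx ac.2 & p n = ac.1 * h * ac.2].
  move=> n; have [/orbit_ofP[a' [c' a'P]]|np] :=
    pselect (orbit_of (@A_group R) (lattice_of h) (lattice_of (p n))).
    by exists (a', c').
  by exists (1, 1).
have acA : \forall n \near U, @A_group R (ac n).1.
  by apply: filterS pA => n /acP[].
have acZ : \forall n \near U, integral_mx (ac n).2.
  by apply: filterS pA => n /acP[].
have ach : (fun n => (ac n).1 * h * (ac n).2) @ U --> h.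
  apply: cvg_trans ph; apply: near_eq_cvg.
  by apply: filterS pA => n /acP[].
have [[a0 [c0 [a0A c0Z hE _ cE]]]|[j j0 /(_ true)]] := diag_limit UU acA acZ ach; last first.
  exact: xF.
have [_ c01] := diag_stabilizer a0A c0Z hE.
have [n [/acP[a'A _ pE] cn1]] := filter_ex (filterI pA cE).
move: pE; rewrite cn1 c01 mulg1 => /mulIg pE.
have la : a n * l = l * (ac n).1 by rewrite -pE !mulgA mulgV mul1g.
have a_inj j k : val (a n) j j = val (a n) k k -> j = k.
  rewrite (aP n).2 !mxE !eqxx !mulr1n.
  exact: geometric3_inj.
have [j [m [m' [lr lc]]]] := commuting_diag_monomial i (aP n).1 a'A a_inj la.
apply: (@h_splits j); apply: (block_orbit_splits (sh_rat i0) (b_base i0) lr lc (pos := true)).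
by rewrite -act_lattice_of lE.
Qed.

(** Bounded representatives have a limit along an ultrafilter, which lies in the
    closure of the diagonal orbit and, by the analysis of unbounded diagonal
    elements, in the block orbit. *)
Lemma diag_orbit_meets_block i pos : i != 0%R ->
  (forall n : nat, exists a c, [/\ @A_group R a, integral_mx c, val a i i = 1%R,
     forall k, k != 0%R -> k != i -> (n.+1%:R <= val a k k)%R &
     forall k l, (`|val (a * h * c)%g k l| <= 1)%R]) ->
  closure (orbit_of (@A_group R) (lattice_of h)) `&`
    orbit_of (block_group i pos) (lattice_of (b i)) !=set0.
Proof.
move=> i0 bnd.
have /choice[ac acP] : forall n, exists ac : SL3 R * SL3 R,
    [/\ @A_group R ac.1, integral_mx ac.2, val ac.1 i i = 1%R,
     forall k, k != 0%R -> k != i -> (n.+1%:R <= val ac.1 k k)%R &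
     forall k l, (`|val (ac.1 * h * ac.2)%g k l| <= 1)%R].
  by move=> n; have [a [c acP]] := bnd n; exists (a, c).
have [U [UU sU]] := ultraFilterLemma (@eventually_filter).
pose G n := (ac n).1 * h * (ac n).2.
have /choice[M GM] : forall kl : 'I_3 * 'I_3, exists m : R,
    (fun n => val (G n) kl.1 kl.2) @ U --> m.
  move=> kl; apply: (@ultra_bounded_cvg _ _ _ _ _ 1%R).
  by apply: filterS filterT => n _; have [_ _ _ _] := acP n; apply.
pose M' : 'M[R]_3 := \matrix_(k, l) M (k, l).
have GM' : (fun n => val (G n)) @ U --> M'.
  by apply/cvg_mxP => k l; rewrite mxE; exact: GM (k, l).
have detM : \det M' == 1%R.
  apply/eqP; apply: (@cvg_unique _ (@norm_hausdorff _ _) _ _ _ _ (cvg_det GM')).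
  have -> : (fun n => \det (val (G n))) = (fun=> 1%R).
    by apply/funext => n; exact: SL3_det.
  exact: cvg_cst.
pose g : SL3 R := Sub M' detM.
have Gg : G @ U --> g by apply/cvg_SL3P.
have aA : \forall n \near U, @A_group R (ac n).1.
  by apply: filterS filterT => n _; have [] := acP n.
have cZ : \forall n \near U, integral_mx (ac n).2.
  by apply: filterS filterT => n _; have [] := acP n.
exists (lattice_of g); split; first exact: closure_orbit_cvg aA cZ Gg.
apply: (diag_limit_block aA cZ Gg pos i0 (l0 := 1%R)).
  by apply: cvg_near_cst; apply: filterS filterT => n _; have [] := acP n.
move=> k k0 ki; apply: cvg_trans (_ : (fun n => (val (ac n).1 k k)^-1%R) @ \oo --> _).
  by move=> B; exact: sU.
apply: (squeeze_cvgr _ (cvg_cst 0%R) cvg_harmonic); apply: nearW => n.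
have [_ _ _ /(_ k k0 ki) na _] := acP n.
have a_pos : (0 < val (ac n).1 k k)%R by apply: lt_le_trans na; rewrite ltr0n.
by rewrite invr_ge0 (ltW a_pos) /= lef_pV2 // posrE ltr0n.
Qed.

End DiagonalOrbit.

(** * Diophantine approximation *)

Section Approximation.
Variable R : realType.
Implicit Types (x y : R) (n k : int).

Lemma rational_div n k : @rational R (n%:~R / k%:~R).
Proof. by exists (n%:~R / k%:~R) => //; rewrite fmorph_div /= !ratr_int. Qed.

(** By induction along the continued fraction expansion of [x]: if [- k1 / n1] and
    [- k2 / n2] are consecutive convergents, the quotient of the errors
    [n1 * x + k1] and [n2 * x + k2] is kept below -1, which makes the denominators
    grow. *)
Lemma consecutive_convergents x (N : nat) : irrational x ->
  exists n1 k1 n2 k2 : int, [/\ 0 <= n1 <= n2, 0 < n2, N%:Z <= n1 + n2,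
    (n1 * k2 - n2 * k1) ^+ 2 = 1 &
    (n1%:~R * x + k1%:~R) / (n2%:~R * x + k2%:~R) < -1].
Proof.
move=> xirr.
have err_neq0 n k : 0 < n -> n%:~R * x + k%:~R != 0.
  move=> n0; apply/eqP => e; apply: xirr.
  have -> : x = (- k)%:~R / n%:~R.
    have nR : n%:~R != 0 :> R by rewrite intr_eq0 gt_eqF.
    by apply: (mulIf nR); rewrite divfK // rmorphN /= mulrC -[RHS]add0r -e addrK.
  exact: rational_div.
(* the first two convergents are 1/0 and the ceiling of [x], up to sign *)
elim: N => [|N [n1 [k1 [n2 [k2 [/andP[n1_ge0 n12] n2_gt0 Nn det1 err]]]]]].
  exists 0, 1, 1, (- Num.floor x - 1); split=> //; first by ring.
  have /andP[fx xf] := floor_itv x.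
  have fx_lt : (Num.floor x)%:~R < x.
    rewrite lt_neqAle fx andbT; apply/eqP => fxE; apply: xirr.
    by rewrite -fxE -[X in rational X]divr1; exact: (rational_div _ 1).
  rewrite !mul1r mul0r add0r rmorphB rmorphN /=.
  rewrite intrD mulr1z in xf; rewrite ltr_ndivrMr ?mulN1r; lra.
set e1 := n1%:~R * x + k1%:~R in err; set e2 := n2%:~R * x + k2%:~R in err.
pose a := Num.floor (- (e1 / e2)).
have a1 : 1 <= a by rewrite floor_ge_int /= mulr1z lerNr ltW.
exists n2, k2, (n1 + a * n2), (k1 + a * k2).
have n2a : n2 <= a * n2 by rewrite ler_peMl // ltW.
have n3_gt0 : 0 < n1 + a * n2 by lia.
split=> //.
- by apply/andP; split; lia.
- by lia.
- by rewrite -[RHS]det1; ring.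
have e2_neq0 := err_neq0 n2 k2 n2_gt0.
have e3_neq0 := err_neq0 _ (k1 + a * k2) n3_gt0.
have e3E : (n1 + a * n2)%:~R * x + (k1 + a * k2)%:~R = e1 + a%:~R * e2.
  by rewrite /e1 /e2 !rmorphD !rmorphM /=; ring.
rewrite e3E in e3_neq0 *.
have q_neq0 : (e1 + a%:~R * e2) / e2 != 0 by rewrite mulf_neq0 ?invr_eq0.
rewrite -/e2 -invf_div; move: q_neq0; rewrite mulrDl mulfK // => q_neq0.
have /andP[ae ea] := floor_itv (- (e1 / e2)); rewrite -/a in ae ea.
rewrite intrD mulr1z in ea.
move: err q_neq0 ae ea; move: (e1 / e2) (a%:~R) => q A q1 q_neq0 Aq qA.
have q_lt0 : q + A < 0 by rewrite lt_neqAle q_neq0 /=; lra.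
by rewrite -ltrN2 opprK -invrN invf_gt1 ?oppr_gt0 //; lra.
Qed.

(** The errors [e1] and [e2] of consecutive convergents have opposite signs, so
    the identity [n1 * e2 - n2 * e1 = 1], up to sign, is a sum of nonnegative
    terms and bounds [n2 * e1]. *)
Lemma unimodular_approximation x (N : nat) : irrational x ->
  exists n1 k1 n2 k2 : int, [/\ n1 * k2 - n2 * k1 = 1,
    N.+1%:R <= `|n2%:~R : R|, `|n1%:~R : R| <= `|n2%:~R : R|,
    `|n2%:~R : R| * `|n1%:~R * x + k1%:~R| <= 1 &
    `|n2%:~R : R| * `|n2%:~R * x + k2%:~R| <= 1].
Proof.
move=> /(consecutive_convergents (N.+1 * 2)).
move=> [n1 [k1 [n2 [k2 [/andP[n1_ge0 n12] n2_gt0 Nn det1 err]]]]].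
set e1 := n1%:~R * x + k1%:~R in err; set e2 := n2%:~R * x + k2%:~R in err.
have n2R : 0 < n2%:~R :> R by rewrite ltr0z.
have n1R : 0 <= n1%:~R :> R by rewrite ler0z.
have e2_neq0 : e2 != 0.
  by apply/eqP => e20; move: err; rewrite e20 invr0 mulr0; lra.
have e21 : `|e2| <= `|e1|.
  have : 1 <= `|e1 / e2| by rewrite ltr0_norm; lra.
  by rewrite normf_div ler_pdivlMr ?normr_gt0 // mul1r.
have det_e : `|n1%:~R * e2 - n2%:~R * e1| = 1.
  have -> : n1%:~R * e2 - n2%:~R * e1 = (n1 * k2 - n2 * k1)%:~R.
    by rewrite /e1 /e2 rmorphB !rmorphM /=; ring.
  by have /eqP := det1; rewrite sqrf_eq1 => /orP[] /eqP->; rewrite ?rmorphN ?normrN normr1.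
have n2e1 : n2%:~R * `|e1| <= 1.
  have : (n1%:~R + n2%:~R * - (e1 / e2)) * `|e2| = 1.
    have -> : n1%:~R + n2%:~R * - (e1 / e2) = `|n1%:~R + n2%:~R * - (e1 / e2)|.
      by rewrite ger0_norm // addr_ge0 // mulr_ge0 // ?ltW //; lra.
    by rewrite -normrM -[RHS]det_e mulrDl mulrN mulNr -mulrA divfK.
  rewrite mulrDl -mulrA => eqn1; rewrite -[leRHS]eqn1 -[in leLHS](divfK e2_neq0 e1) normrM.
  have q_lt0 : e1 / e2 < 0 by apply: lt_trans err _; rewrite oppr_lt0.
  by rewrite (ltr0_norm q_lt0) lerDr mulr_ge0.
have n2e2 : n2%:~R * `|e2| <= 1.
  by apply: le_trans n2e1; rewrite ler_pM2l.
have Nn2 : N.+1%:R <= n2%:~R :> R.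
  by rewrite -[_%:R]/((N.+1)%:Z%:~R) ler_int; lia.
move: det1 => /eqP; rewrite sqrf_eq1 => /orP[] /eqP det1.
  exists n1, k1, n2, k2; rewrite (gtr0_norm n2R) (ger0_norm n1R); split=> //.
  by rewrite ler_int.
exists (- n1), (- k1), n2, k2.
have -> : (- n1)%:~R * x + (- k1)%:~R = - e1 by rewrite !mulrNz mulNr -opprD.
rewrite mulrNz !normrN (gtr0_norm n2R) (ger0_norm n1R); split=> //.
  by rewrite -[RHS]opprK -det1; ring.
by rewrite ler_int.
Qed.

End Approximation.

(** * Duality of lattices *)

Section Duality.
Variable R : realType.
Local Open Scope group_scope.
Implicit Types (g h : SL3 R) (x y : X3 R) (S : set (SL3 R)) (i : 'I_3).

Fact dual_det g : \det (val g^-1)^T == 1%R.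
Proof. by rewrite det_tr SL3_det. Qed.

(** Passage to the dual lattice: if the columns of [g] form a basis of a lattice,
    then those of [dual g] form the dual basis. *)
Definition dual g : SL3 R := Sub (val g^-1)^T (dual_det g).

Lemma dualM g h : dual (g * h) = dual g * dual h.
Proof. by apply: val_inj; rewrite /= -trmx_mul -[X in X^T]/(val (g * h)^-1) invgM. Qed.

Lemma dual1 : dual 1 = 1.
Proof. by apply: val_inj; rewrite /= invmx1 trmx1. Qed.

Lemma dualV g : dual g^-1 = (dual g)^-1.
Proof. by apply: (mulIg (dual g)); rewrite -dualM !mulVg dual1. Qed.

Lemma dualK : involutive dual.
Proof. by move=> g; apply: val_inj; rewrite /= trmx_inv trmxK invmxK. Qed.

Lemma dual_integral g : integral_mx g -> integral_mx (dual g).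
Proof.
by move=> /integral_mxV/mxOverP gZ; apply/mxOverP => i j; rewrite mxE; exact: gZ.
Qed.

Lemma dual_continuous : continuous dual.
Proof.
move=> g; have gV : (fun h => h^-1) @ g --> g^-1.
  by apply: (@cvg_SL3V _ _ (nbhs g) _ id); exact: cvg_id.
apply: (@cvg_SL3P _ _ (nbhs g) _ dual (dual g)).2.
apply/cvg_mxP => i j; rewrite mxE; under eq_cvg do rewrite mxE.
exact: (@cvg_SL3_entry _ _ (nbhs g) _ (fun h => h^-1) (g^-1)).
Qed.

Definition dual_lattice x : X3 R := lattice_of (dual (repr x)).

Lemma dual_lattice_of g : dual_lattice (lattice_of g) = lattice_of (dual g).
Proof.
have /lattice_of_mulZ[c cZ gE] := lattice_of_repr (lattice_of g).
apply/lattice_of_mulZ; exists (dual c); first exact: dual_integral.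
by rewrite gE dualM.
Qed.

Lemma dual_latticeK : involutive dual_lattice.
Proof.
by move=> x; rewrite -[x]lattice_of_repr !dual_lattice_of dualK.
Qed.

Lemma dual_lattice_continuous : continuous dual_lattice.
Proof.
apply/quotient_continuous => g.
have -> : dual_lattice \o \pi_(X3 R)%qT = @lattice_of R \o dual.
  by apply/funext => k; exact: dual_lattice_of.
by apply: continuous_comp; [exact: dual_continuous|exact: lattice_of_continuous].
Qed.

Lemma dual_act g x : dual_lattice (act g x) = act (dual g) (dual_lattice x).
Proof.
rewrite -[x]lattice_of_repr; move: (repr x) => h.
by rewrite act_lattice_of !dual_lattice_of act_lattice_of dualM.
Qed.

Lemma dual_orbit S x :
  orbit_of S (dual_lattice x) = dual_lattice @^-1` orbit_of (dual @^-1` S) x.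
Proof.
apply/seteqP; split=> y [g Sg gE]; exists (dual g).
- by rewrite /= dualK.
- by rewrite -gE dual_act dual_latticeK.
- exact: Sg.
- by rewrite -dual_act gE dual_latticeK.
Qed.

Lemma dual_closure (B : set (X3 R)) :
  closure (dual_lattice @^-1` B) = dual_lattice @^-1` closure B.
Proof.
have sub C : closure (dual_lattice @^-1` C) `<=` dual_lattice @^-1` closure C.
  move=> y cly V /dual_lattice_continuous/cly[z [Cz Vz]].
  by exists (dual_lattice z).
apply/seteqP; split; first exact: sub.
move=> y cly; rewrite -[y]dual_latticeK; apply: sub.
suff -> : dual_lattice @^-1` (dual_lattice @^-1` B) = B by [].
by apply/seteqP; split=> z /=; rewrite dual_latticeK.
Qed.

Lemma dual_block_group i pos :
  dual @^-1` (@block_group R i pos) = @block_group R i pos.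
Proof.
have sub g : block_group i pos g -> block_group i pos (dual g).
  move=> [l [gl gl' lpos]]; have l0 := SL3_col_eig_neq0 gl.
  exists l^-1%R; split; last by move=> /lpos; rewrite invr_gt0.
    by rewrite -trmx_delta -trmx_mul (SL3V_row l0 gl') linearZ.
  by rewrite -trmx_delta -trmx_mul (SL3V_col l0 gl) linearZ.
by apply/seteqP; split=> g => [/sub|/sub//]; rewrite dualK.
Qed.

Lemma dual_A_group : dual @^-1` (@A_group R) = @A_group R.
Proof.
have sub g : @A_group R g -> @A_group R (dual g).
  move=> /A_groupP[d dpos gE]; apply/A_groupP.
  exists (\row_i (d 0 i)^-1%R) => [i|]; first by rewrite mxE invr_gt0.
  have dV : diag_mx (\row_i (d 0 i)^-1%R) *m val g = 1%:M.
    rewrite gE mulmx_diag -diag_const_mx; congr diag_mx.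
    by apply/matrixP => i j; rewrite ord1 !mxE mulVf // gt_eqF.
  rewrite /= -[invmx _]mul1mx -dV mulmxK ?SL3_unit //.
  by rewrite tr_diag_mx.
by apply/seteqP; split=> g => [/sub|/sub//]; rewrite dualK.
Qed.

Lemma dual_closed_reductive_orbit i pos y :
  closed_reductive_orbit (block_group i pos) y ->
  closed_reductive_orbit (block_group i pos) (dual_lattice y).
Proof.
move=> [Hr HA Hc]; split=> //; rewrite dual_orbit dual_block_group.
by apply: preimage_closed Hc => z _; exact: dual_lattice_continuous.
Qed.

Lemma dual_orbit_closure_in x i j pos pos' y y' :
  orbit_closure_in x (block_group i pos) (block_group j pos') y y' ->
  orbit_closure_in (dual_lattice x) (block_group i pos) (block_group j pos')
    (dual_lattice y) (dual_lattice y').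
Proof.
move=> [cl d1 d2 m1 m2]; split.
all: rewrite !dual_orbit !dual_block_group !dual_A_group ?dual_closure.
- by move=> z /cl.
- by rewrite -preimage_setI d1 preimage_set0.
- by rewrite -preimage_setI d2 preimage_set0.
- by case: m1 => z zP; exists (dual_lattice z); rewrite /= dual_latticeK.
- by case: m2 => z zP; exists (dual_lattice z); rewrite /= dual_latticeK.
Qed.

Lemma dual_irregular x : irregular x -> irregular (dual_lattice x).
Proof.
move=> xirr [L [[L1 LV] Lc AL clL]]; apply: xirr.
exists (dual @^-1` L); split.
- by split=> [|g h Lg Lh]; rewrite /= ?dual1 // dualM dualV; exact: LV.
- by apply: preimage_closed Lc => g _; exact: dual_continuous.
- by rewrite -dual_A_group => g /AL.
move: clL; rewrite !dual_orbit dual_A_group dual_closure => /seteqP[cl1 cl2].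
by apply/seteqP; split=> z zP; rewrite -[z]dual_latticeK; [apply: cl1|apply: cl2];
  rewrite /= dual_latticeK.
Qed.

End Duality.

(** * The lattices attached to a rationally dependent vector *)

Section RationallyDependent.
Variable R : realType.
Implicit Types (alpha beta x : R) (i j k : 'I_3).
Local Notation e i := (delta_mx i (0 : 'I_1) : 'cV[R]_3).
Local Notation er i := (delta_mx (0 : 'I_1) i : 'rV[R]_3).
Local Notation i1 := (1 : 'I_3).
Local Notation i2 := (2 : 'I_3).

(** The factor [m] on the first axis is free: it serves to keep two such bases
    apart. *)
Lemma block_base_exists i (t : 'rV[R]_3) (m : R) : i != 0 -> m != 0 -> t 0 i = 1 ->
  exists2 b, block_base i t b & er 0 *m val b = m *: er 0.
Proof.
move=> i0 m0 ti; pose B : 'M[R]_3 := \matrix_(p, q)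
  (if p == i then t 0 q else (if p == 0 then m else m^-1) *+ (p == q)).
have detB : \det B == 1.
  apply/eqP; rewrite det_mx33 !mxE; elim/ord3P: i i0 ti {B} => //= _ ti.
    by rewrite ti; field.
  by rewrite ti; field.
exists (Sub B detB : SL3 R); first split.
- apply/matrixP => p q; rewrite ord1 mx_delta_row !mxE andbT.
  by case: eqVneq => _; rewrite ?ti ?mulr0n.
- by apply/matrixP => p q; rewrite ord1 delta_col_mx !mxE eqxx.
apply/matrixP => p q; rewrite ord1 delta_col_mx !mxE (eq_sym 0 i) (negPf i0) eqxx /=.
by rewrite mulr_natr eq_sym.
Qed.

Lemma h_mxE alpha beta i j : h_mx alpha beta i j =
  if j == 0 then (if i == 0 then 1 else if i == i1 then alpha else beta)
  else (i == j)%:R.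
Proof. by rewrite !mxE; elim/ord3P: i; elim/ord3P: j. Qed.

Lemma h_mx_col alpha beta i : i != 0 -> h_mx alpha beta *m e i = e i.
Proof.
move=> i0; apply/matrixP => p q.
by rewrite ord1 mx_delta_row h_mxE (negPf i0) mxE andbT.
Qed.

Lemma row_h_mx alpha beta (s : 'rV[R]_3) : s *m h_mx alpha beta =
  \row_k (if k == 0 then s 0 0 + s 0 i1 * alpha + s 0 i2 * beta else s 0 k).
Proof.
apply/matrixP => p k; rewrite ord1 !mxE sum_ord3 !h_mxE.
by elim/ord3P: k => /=; rewrite ?mulr1 ?mulr0 ?addr0 ?add0r.
Qed.

Lemma integral_up_to_scale_ratr (t : 'I_3 -> rat) :
  integral_up_to_scale (\row_k ratr (t k) : 'rV[R]_3).
Proof.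
exists ((denq (t 0) * denq (t i1) * denq (t i2))%:~R : R).
  by rewrite intr_eq0 !mulf_neq0 ?denq_eq0.
apply/mxOverP => p k; rewrite !mxE.
have tE q : (denq q)%:~R * ratr q = (numq q)%:~R :> R.
  by rewrite /ratr mulrCA mulfV ?mulr1 // intr_eq0 denq_eq0.
have rE : forall q : rat, ((denq q)%:~R * ratr q : R) \is a Num.int.
  by move=> q; rewrite tE intr_int.
have rE3 q1 q2 q :
    ((denq q1)%:~R * (denq q2)%:~R * ((denq q)%:~R * ratr q) : R) \is a Num.int.
  by apply: rpredM; [rewrite rpredM ?intr_int|exact: rE].
rewrite !rmorphM /=; elim/ord3P: k.
- by have := rE3 (t i1) (t i2) (t 0); congr (_ \is a _); ring.
- by have := rE3 (t 0) (t i2) (t i1); congr (_ \is a _); ring.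
- by have := rE3 (t 0) (t i1) (t i2); congr (_ \is a _); ring.
Qed.

Lemma proportional_rational x (m : R) (u v : R) :
  u \is a Num.int -> v \is a Num.int -> x = m * u -> 1 = m * v -> rational x.
Proof.
move=> /intrP[n ->] /intrP[k ->] -> mk; have k0 : k%:~R != 0 :> R.
  by apply/eqP => k0; move: mk; rewrite k0 mulr0 => /eqP; rewrite oner_eq0.
have -> : m = k%:~R^-1 by apply: (mulIf k0); rewrite -mk mulVf.
by rewrite mulrC; exact: rational_div.
Qed.

(** The rows of the matrix are [(1, 0, 0)], [(alpha, 1, 0)] and [(beta, 0, 1)]: only
    the first one is proportional to a rational row, but the first axis contains
    no lattice vector, as [(1, - alpha, - beta)] is not proportional to a rational
    vector. *)
Lemma h_v_not_split alpha beta i : irrational alpha -> irrational beta ->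
  ~ axis_splits (h_v alpha beta) i.
Proof.
move=> airr birr [[m [u [/mxOverP uZ uE]]] [m' [u' [/mxOverP uZ' uE']]]].
have row_u k : h_mx alpha beta i k = m * u 0 k.
  by have /matrixP/(_ 0 k) := uE; rewrite delta_col_mx [in RHS]mxE => <-.
elim/ord3P: i uE uE' row_u => uE uE' row_u.
- have hV : h_mx alpha beta *m (\col_k (if k == 0 then 1 else - h_mx alpha beta k 0)) = e 0.
    apply/matrixP => p q; rewrite ord1 !mxE sum_ord3 !mxE.
    by elim/ord3P: p => /=; ring.
  have col_u k : (if k == 0 then 1 else - h_mx alpha beta k 0) = m' * u' k 0.
    have /matrixP/(_ k 0) : \col_k (if k == 0 then 1 else - h_mx alpha beta k 0) = m' *: u'.
      by rewrite -uE' -hV (mulKmx (SL3_unit (h_v alpha beta))).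
    by rewrite !mxE.
  apply: airr; apply: (@proportional_rational _ m' (- u' i1 0) (u' 0 0)).
  + by rewrite rpredN.
  + exact: uZ'.
  + by rewrite mulrN -col_u h_mxE opprK.
  + by rewrite -col_u.
- apply: airr; apply: (@proportional_rational _ m (u 0 0) (u 0 i1)) => //.
    by rewrite -row_u h_mxE.
  by rewrite -row_u h_mxE.
- apply: birr; apply: (@proportional_rational _ m (u 0 0) (u 0 i2)) => //.
    by rewrite -row_u h_mxE.
  by rewrite -row_u h_mxE.
Qed.

(** Diophantine approximation of the j-th coordinate of [v] produces short
    vectors once the first axis is contracted and the j-th one expanded; the
    i-th coordinate of these vectors is reduced modulo the lattice vector on
    the i-th axis. *)
Lemma bounded_representatives alpha beta i (n : nat) :
  irrational alpha -> irrational beta -> i != 0 ->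
  exists a c : SL3 R, [/\ A_group a, integral_mx c, val a i i = 1,
    forall k, k != 0 -> k != i -> n.+1%:R <= val a k k &
    forall k l, `|val (a * h_v alpha beta * c)%g k l| <= 1].
Proof.
move=> airr birr i0.
pose th k : R := if k == i1 then alpha else beta.
(* the axis other than the first and the i-th, as 0 + 1 + 2 = 0 modulo 3 *)
pose j : 'I_3 := - i.
have ij : i == j = false by rewrite /j; move: {j} i i0; elim/ord3P.
have jE k : k != 0 -> k != i -> k = j.
  rewrite /j => k0 ki; apply/eqP; move: {j ij} i i0 k0 ki.
  by elim/ord3P; elim/ord3P: k.
have thirr : irrational (th j) by rewrite /th; case: ifP.
have [n1 [k1 [n2 [k2 [det1 nn2 n12 ne1 ne2]]]]] := unimodular_approximation n thirr.
pose N (l : 'I_3) := if l == 0 then n1 else n2.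
pose K (l : 'I_3) := if l == 0 then k1 else k2.
pose C : 'M[R]_3 := \matrix_(k, l) (if l == i then (k == i)%:R else
  if k == 0 then (N l)%:~R else if k == j then (K l)%:~R
  else (- Num.floor (th i * (N l)%:~R))%:~R).
have detC : \det C == 1.
  rewrite det_mx33 !mxE /N /K /j; apply/eqP.
  have /(congr1 (fun z : int => z%:~R : R)) := det1.
  rewrite rmorphB !rmorphM /= => {}det1.
  by elim/ord3P: i i0 {j jE ij thirr C ne1 ne2} => //= _; rewrite -[RHS]det1; ring.
pose c : SL3 R := Sub C detC.
pose c2 : R := `|n2%:~R|.
have c2_gt0 : 0 < c2 by apply: lt_le_trans nn2; rewrite ltr0n.
have [||a aA aE] := @A_group_of R (\row_k
    (if k == 0 then c2^-1 else if k == i then 1 else c2)).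
- by move=> k; rewrite mxE; case: ifP => _; [rewrite invr_gt0|case: ifP].
- rewrite !mxE; elim/ord3P: i i0 {j jE ij thirr C detC c ne1 ne2} => //= _.
    by rewrite mulr1 mulVf ?gt_eqF.
  by rewrite mulr1 mulVf ?gt_eqF.
exists a, c; split=> //.
- apply/mxOverP => k l; rewrite !mxE.
  by case: ifP => _; [exact: rpred_nat|do 2?[case: ifP => _]; exact: intr_int].
- by rewrite aE !mxE eqxx mulr1n (negPf i0).
- by move=> k k0 ki; rewrite aE !mxE eqxx mulr1n (negPf k0) (negPf ki).
move=> k l; have hC : (h_mx alpha beta *m C) k l =
    if k == 0 then C 0 l else th k * C 0 l + C k l.
  rewrite mxE sum_ord3 !h_mxE; elim/ord3P: k => /=.
  - by rewrite mul1r !mul0r !addr0.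
  - by rewrite mul1r !mul0r !addr0.
  - by rewrite mul1r !mul0r !addr0.
rewrite -[val _]/(val a *m h_mx alpha beta *m C) aE -mulmxA mul_diag_mx mxE hC.
rewrite !mxE [0 == i]eq_sym (negPf i0) eqxx.
have [_|li] := eqVneq l i.
  rewrite mulr0 add0r; case: (k == 0); first by rewrite mulr0 normr0.
  by case: (k == i); rewrite ?mul1r ?normr1 // mulr0 normr0.
have NK : `|(N l)%:~R : R| <= c2 /\ c2 * `|(N l)%:~R * th j + (K l)%:~R| <= 1.
  by rewrite /N /K; case: ifP.
have [_|k0] := eqVneq k 0.
  by rewrite normrM gtr0_norm ?invr_gt0 // ler_pdivrMl // mulr1; case: NK.
have [->|ki] := eqVneq k i.
  rewrite ij.
  have /andP[f0 f1] := floor_itv (th i * (N l)%:~R).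
  rewrite mul1r mulrNz ger0_norm; first by rewrite intrD mulr1z in f1; lra.
  by rewrite subr_ge0.
rewrite (jE k k0 ki).
by rewrite eqxx normrM (gtr0_norm c2_gt0) [th j * _]mulrC; case: NK.
Qed.

End RationallyDependent.

Section OrbitClosure.
Variable R : realType.
Local Notation er i := (delta_mx (0 : 'I_1) i : 'rV[R]_3).

Lemma rat_dependent_neq0 (alpha beta : R) (p q r : rat) :
  irrational alpha -> irrational beta -> (p, q, r) <> (0, 0, 0) ->
  ratr p * 1 + ratr q * alpha + ratr r * beta = 0 -> q != 0 /\ r != 0.
Proof.
have aux (x : R) (p' q' : rat) : irrational x -> ratr p' + ratr q' * x = 0 ->
    p' = 0 /\ q' = 0.
  move=> xirr pq; have q0 : q' = 0.
    apply/eqP; apply: contrapT => /negP q0; apply: xirr; exists (- p' / q') => //.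
    have q0R : ratr q' != 0 :> R by rewrite fmorph_eq0.
    rewrite fmorph_div rmorphN /=; apply: (mulfI q0R).
    by apply/eqP; rewrite mulrCA mulfV // mulr1 eq_sym -addr_eq0 addrC pq.
  by move: pq; rewrite q0 rmorph0 mul0r addr0 => /eqP; rewrite fmorph_eq0 => /eqP.
move=> airr birr pqr0; rewrite mulr1 => rel; split; apply/eqP => z0.
  move: rel; rewrite z0 rmorph0 mul0r addr0 => /(aux _ _ _ birr)[pz rz].
  by apply: pqr0; rewrite pz z0 rz.
move: rel; rewrite z0 rmorph0 mul0r addr0 => /(aux _ _ _ airr)[pz qz].
by apply: pqr0; rewrite pz qz z0.
Qed.

Lemma x_v_orbit_closure (alpha beta : R) (pos : bool) :
  irrational alpha -> irrational beta -> rat_dependent alpha beta ->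
  exists y1 y2 : X3 R, [/\ y1 <> y2,
    closed_reductive_orbit (block_group 1 pos) y1,
    closed_reductive_orbit (block_group 2 pos) y2,
    orbit_closure_in (x_v alpha beta) (block_group 1 pos) (block_group 2 pos) y1 y2 &
    irregular (x_v alpha beta)].
Proof.
move=> airr birr [p [q [r [pqr0 rel]]]].
have [q0 r0] := rat_dependent_neq0 airr birr pqr0 rel.
pose s : 'rV[R]_3 := \row_k ratr (if k == 0 then 0 else if k == 1 then q else r).
pose t : 'rV[R]_3 := s *m val (h_v alpha beta).
have s0 : s 0 0 = 0 by rewrite mxE rmorph0.
have s_neq0 k : k != 0 -> s 0 k != 0.
  by move=> k0; rewrite mxE (negPf k0) fmorph_eq0; case: ifP.
have tE : t = \row_k ratr (if k == 0 then - p else if k == 1 then q else r).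
  rewrite /t row_h_mx; apply/matrixP => i k; rewrite !mxE.
  case: eqVneq => // _; rewrite eqxx /= rmorph0 add0r rmorphN /=.
  by apply/eqP; rewrite -addr_eq0 addrC addrA -[X in X + _ + _]mulr1 rel.
have st_rat k : k != 0 -> integral_up_to_scale ((s 0 k)^-1 *: t).
  move=> k0; have [N N0 NtZ] : integral_up_to_scale t by rewrite tE; exact: integral_up_to_scale_ratr.
  exists (N * s 0 k); first by rewrite mulf_neq0 ?s_neq0.
  by rewrite scalerA mulfK ?s_neq0.
have /choice[b bP] : forall k : 'I_3, exists b : SL3 R, k != 0 ->
    block_base k ((s 0 k)^-1 *: t) b /\
    er 0 *m val b = (if k == 1 then 2 else 1) *: er 0.
  move=> k; have [->|k0] := eqVneq k 0; first by exists 1%g.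
  have [|||b bb b0] := @block_base_exists _ k ((s 0 k)^-1 *: t) (if k == 1 then 2 else 1).
  - exact: k0.
  - by case: ifP => _; rewrite ?oner_eq0 // pnatr_eq0.
  - have tk : t 0 k = s 0 k by rewrite tE !mxE (negPf k0).
    by rewrite mxE tk mulVf ?s_neq0.
  by exists b.
have b_base k (k0 : k != 0) := (bP k k0).1.
have h_col k : k != 0 -> val (h_v alpha beta) *m delta_mx k (0 : 'I_1) = delta_mx k 0.
  exact: h_mx_col.
have h_split k := @h_v_not_split R alpha beta k airr birr.
have bnd k (k0 : k != 0) n := bounded_representatives n airr birr k0.
have meets k ps (k0 : k != 0) :=
  diag_orbit_meets_block h_col s0 s_neq0 st_rat b_base ps k0 (bnd k k0).
have disj k (k0 : k != 0) := diag_orbit_block_disjoint st_rat b_base h_split pos k0.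
have cro k (k0 : k != 0) : closed_reductive_orbit (block_group k pos) (lattice_of (b k)).
  split; first exact: block_group_reductive.
    exact: A_block_group.
  exact: block_orbit_closed (st_rat k k0) (b_base k k0).
exists (lattice_of (b 1)), (lattice_of (b 2)); split.
- (* an integral change of basis would have 1/2 as an entry *)
  move=> /esym/lattice_of_mulZ[c /mxOverP cZ b21].
  have := congr1 (fun g : SL3 R => er 0 *m val g) b21.
  rewrite /= mulmxA !(bP _ _).2 //= scale1r -scalemxAl => /matrixP/(_ 0 0).
  rewrite [in RHS]mxE delta_col_mx mxE !eqxx => c2; have /intrP[z zE] := cZ 0 0.
  have : 1%:~R = (2 * z)%:~R :> R by rewrite intrM -zE -c2.
  by move=> /intr_inj; lia.
- exact: cro.
- exact: cro.
- split; [|exact: disj|exact: disj|exact: meets|exact: meets].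
  move=> y /(closure_diag_orbit h_col s0 s_neq0 st_rat b_base)[yA|[k /= k0 /(_ pos I) yk]].
    by left; left.
  by elim/ord3P: k k0 yk => // _ yk; [left; right|right].
- exact: (diag_orbit_irregular h_col s0 s_neq0 st_rat b_base h_split
    (i := 1) isT (meets 1 true isT)).
Qed.

Lemma dual_x_v (alpha beta : R) :
  dual_lattice (x_v (- alpha) (- beta)) = z_v alpha beta.
Proof.
rewrite dual_lattice_of; congr lattice_of; apply: val_inj; rewrite /=.
have hh : h_mx alpha beta *m h_mx (- alpha) (- beta) = 1%:M.
  apply/matrixP => i j; rewrite mxE sum_ord3 !h_mxE mxE.
  by elim/ord3P: i; elim/ord3P: j => /=; ring.
rewrite -[invmx _]mul1mx -hh (mulmxK (SL3_unit (h_v (- alpha) (- beta)))).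
by apply/matrixP => i j; rewrite mxE [in LHS]mxE mxE; elim/ord3P: i; elim/ord3P: j.
Qed.

Lemma irrationalN (x : R) : irrational x -> irrational (- x).
Proof.
move=> xirr [q _ qE]; apply: xirr; exists (- q) => //.
by rewrite rmorphN /= qE opprK.
Qed.

Lemma rat_dependentN (alpha beta : R) :
  rat_dependent alpha beta -> rat_dependent (- alpha) (- beta).
Proof.
move=> [p [q [r [pqr0 rel]]]]; exists p, (- q), (- r); split.
  by move=> [p0 /eqP + /eqP]; rewrite !oppr_eq0 => /eqP q0 /eqP r0; apply: pqr0; rewrite p0 q0 r0.
by rewrite !rmorphN /= !mulrNN.
Qed.

Lemma block_group_neq (i j : 'I_3) (pos pos' : bool) : i != j ->
  @block_group R i pos <> @block_group R j pos'.
Proof.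
move=> ij E; apply: (quarter_turn_notin (R := R) (pos := pos') ij).
by rewrite -E; exact: quarter_turn_in.
Qed.

Lemma block_group_pos_neq (i : 'I_3) :
  @block_group R i true <> @block_group R i false.
Proof.
pose d : 'rV[R]_3 := \row_k (if k == i + 2 then 1 else -1).
have detd : \det (diag_mx d) == 1.
  by rewrite det_diag prod_ord3 !mxE; elim/ord3P: i {d} => /=; apply/eqP; ring.
pose g : SL3 R := Sub (diag_mx d) detd.
have g_false : block_group i false g.
  rewrite block_group_falseE => j ji /=.
  by rewrite !mxE [i == j]eq_sym (negPf ji) !mulr0n.
move=> E; move: g_false; rewrite -E => /block_groupE[_ /(_ isT)].
by rewrite /= !mxE eqxx mulr1n; elim/ord3P: i {d detd g E} => /=; rewrite ltr0N1.
Qed.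

End OrbitClosure.

Theorem theorem1p5 (R : realType) (alpha beta : R)
    (alpha_irr : irrational alpha) (beta_irr : irrational beta)
    (dep : rat_dependent alpha beta) :
  (exists (H1 H2 : set (SL3 R)) (y1 y2 : X3 R)
          (K1 K2 : set (SL3 R)) (w1 w2 : X3 R),
    [/\ [/\ H1 <> H2, y1 <> y2,
            closed_reductive_orbit H1 y1, closed_reductive_orbit H2 y2 &
            orbit_closure_in (x_v alpha beta) H1 H2 y1 y2],
        [/\ K1 <> K2, w1 <> w2,
            closed_reductive_orbit K1 w1, closed_reductive_orbit K2 w2 &
            orbit_closure_in (z_v alpha beta) K1 K2 w1 w2] &
        [/\ K1 <> H1, K1 <> H2, K2 <> H1 & K2 <> H2]])
  /\ irregular (x_v alpha beta)
  /\ irregular (z_v alpha beta).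
Proof.
have [y1 [y2 [y12 y1_cro y2_cro y_cl x_irr]]] :=
  x_v_orbit_closure false alpha_irr beta_irr dep.
have [w1 [w2 [w12 w1_cro w2_cro w_cl w_irr]]] := x_v_orbit_closure true
  (irrationalN alpha_irr) (irrationalN beta_irr) (rat_dependentN dep).
split; last first.
  by split=> //; rewrite -dual_x_v; exact: dual_irregular.
exists (block_group 1 false), (block_group 2 false), y1, y2.
exists (block_group 1 true), (block_group 2 true), (dual_lattice w1), (dual_lattice w2).
split; split=> //.
all: try exact: block_group_neq.
all: try exact: block_group_pos_neq.
- by move=> /(can_inj (@dual_latticeK R)).
- exact: dual_closed_reductive_orbit.
- exact: dual_closed_reductive_orbit.
- by rewrite -dual_x_v; exact: dual_orbit_closure_in.
Qed.
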